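(* Let $a,b,c$ be positive numbers with $a<b<c$, $b-a<c_0<a$, $0<c_1<2a-b$ and $\lfloor c/b\rfloor\ge2$, where $c_0=c-\lfloor c/b\rfloor b$ and $c_1=\lfloor c/b\rfloor b-\lfloor\lfloor c/b\rfloor b/a\rfloor a$. Suppose $\mathcal S_{a,b,c}\ne\emptyset$ and either $a/b\notin\mathbb Q$, or $a/b=p/q$ and $c/b\in\mathbb Z/q$ for some coprime positive integers $p,q$. Then $\mathcal D_{a,b,c}=\emptyset$ if and only if $$(\lfloor c/b\rfloor+1)\,|\mathcal S_{a,b,c}\cap[0,c_0+a-b)|+\lfloor c/b\rfloor\,|\mathcal S_{a,b,c}\cap[c_0,a)|=a,$$ where $|\cdot|$ denotes Lebesgue measure.
   Context: For $a,b,c>0$ and $t\in\mathbb R$, $\mathbf M_{a,b,c}(t)=(\chi_{[0,c)}(t-\mu+\lambda))_{\mu\in a\mathbb Z,\lambda\in b\mathbb Z}$ is the infinite matrix with rows indexed by $a\mathbb Z$ and columns by $b\mathbb Z$, acting by $(\mathbf M_{a,b,c}(t)\mathbf x)(\mu)=\sum_{\lambda\in b\mathbb Z}\chi_{[0,c)}(t-\mu+\lambda)\mathbf x(\lambda)$. $\mathcal B_b^0$ is the set of vectors $(\mathbf x(\lambda))_{\lambda\in b\mathbb Z}$ with entries in $\{0,1\}$ and $\mathbf x(0)=1$. $\mathbf 1,\mathbf 2$ denote the vectors indexed by $a\mathbb Z$ with all entries $1$, resp. $2$. $\mathcal D_{a,b,c}=\{t:\mathbf M_{a,b,c}(t)\mathbf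 x=\mathbf 2\text{ for some }\mathbf x\in\mathcal B_b^0\}$, $\mathcal S_{a,b,c}=\{t:\mathbf M_{a,b,c}(t)\mathbf x=\mathbf 1\text{ for some }\mathbf x\in\mathcal B_b^0\}$. *)

(* Defs.v *)
From Stdlib Require Import Reals ZArith.
Open Scope R_scope.

(* floor function: Int_part r = up r - 1 is exactly floor r *)
Definition rfloor (r : R) : Z := Int_part r.

Definition chi (lo hi u : R) : R :=
  if Rle_dec lo u then (if Rlt_dec u hi then 1 else 0) else 0.

Definition zsum (f : Z -> R) (s : R) : Prop :=
  exists N : nat,
    (forall k : Z, (Z.of_nat N < Z.abs k)%Z -> f k = 0) /\
    s = sum_f_R0 (fun i => f (Z.of_nat i - Z.of_nat N)%Z) (2 * N).

(* B_b^0 : 0/1 vectors indexed by bZ (index k <-> lambda = k b), x(0) = 1 *)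
Definition B0 (x : Z -> R) : Prop :=
  (forall k, x k = 0 \/ x k = 1) /\ x 0%Z = 1.

(* M_{a,b,c}(t) x = v * (all-ones), rows mu = m a, columns lambda = k b *)
Definition Mx_eq_const (a b c t : R) (x : Z -> R) (v : R) : Prop :=
  forall m : Z, zsum (fun k => chi 0 c (t - IZR m * a + IZR k * b) * x k) v.

Definition Dset (a b c : R) (t : R) : Prop :=
  exists x, B0 x /\ Mx_eq_const a b c t x 2.

Definition Sset (a b c : R) (t : R) : Prop :=
  exists x, B0 x /\ Mx_eq_const a b c t x 1.

Definition cover_sum (E : R -> Prop) (s : R) : Prop :=
  exists l u : nat -> R,
    (forall n, l n <= u n) /\
    (forall t, E t -> exists n, l n <= t < u n) /\
    infinite_sum (fun n => u n - l n) s.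

Definition measure_is (E : R -> Prop) (m : R) : Prop :=
  (forall s, cover_sum E s -> m <= s) /\
  (forall m', (forall s, cover_sum E s -> m' <= s) -> m' <= m).

(* Main.v *)
Require Import Defs.
From Stdlib Require Import Reals ZArith List Lra Lia Bool FinFun.
From Stdlib Require Import Classical ClassicalEpsilon.
From Coquelicot Require Import Coquelicot.
Import ListNotations.
Open Scope R_scope.
Set Bullet Behavior "Strict Subproofs".

(** Write [N = floor (c / b)] and call [x : Z -> bool] an [n]-solution at [t] if
    each row of [M(t)] meets exactly [n] elements of [x].  In a 1-solution, the gap
    after an element [k] depends only on [t + k b] modulo [a]: it is [N + 1] on
    [0, c0 + a - b), [N] on [c0, a), and [c0 + a - b, c0) is never visited.  Hence
    two 1-solutions at [t] are equal or disjoint; the union of two disjoint ones is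
    a 2-solution, and every 2-solution splits in this way.

    Right limits of solutions are solutions, because [chi] of [0, c) is
    right-continuous and [{0,1}^Z] is compact.  Since existence of solutions is
    invariant under translation by [aZ + bZ], which is dense in the irrational case
    (in the rational case [M(t)] is constant on the cells of that lattice), an
    [n]-solution at one point yields [n]-solutions at all points.

    So the [N + 1] translates by [0, b, .., N b] of [S] in [0, c0 + a - b) and the
    [N] translates by [0, .., (N - 1) b] of [S] in [c0, a), taken modulo [a], always
    cover the circle, and cover it twice if [D] is nonempty: the weighted sum is at
    least [a], respectively [2 a].  If [D] is empty, the translates are disjoint and
    uniqueness makes membership in [S] locally constant to the right, so that [S] is
    a union of intervals up to small error and the sum is at most [a]. *)

(** * Counting integers and summing 0/1 families *)

Definition cardinal (n : nat) (P : Z -> Prop) : Prop :=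
  exists L : list Z, NoDup L /\ length L = n /\ forall k, In k L <-> P k.

Lemma cardinal_ext (n : nat) (P Q : Z -> Prop) :
  (forall k, P k <-> Q k) -> cardinal n P -> cardinal n Q.
Proof.
  intros PQ (L & HL & Hn & HP); exists L; repeat split; auto.
  - intros Hk; now apply PQ, HP.
  - intros Hk; now apply HP, PQ.
Qed.

Lemma cardinal_shift (n : nat) (P : Z -> Prop) (j : Z) :
  cardinal n P -> cardinal n (fun k => P (k + j)%Z).
Proof.
  intros (L & HL & Hn & HP); exists (map (fun k => (k - j)%Z) L).
  split; [|split].
  - apply Injective_map_NoDup; auto.
    intros u v; lia.
  - now rewrite length_map.
  - intros k; rewrite in_map_iff; split.
    + intros (y & <- & Hy); apply HP in Hy.
      now replace (y - j + j)%Z with y by lia.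
    + intros Hk; exists (k + j)%Z; split; [lia|now apply HP].
Qed.

Lemma cardinal1_elim (P : Z -> Prop) :
  cardinal 1 P -> exists k, P k /\ forall k', P k' -> k' = k.
Proof.
  intros ([|k [|k2 L]] & HL & Hn & HP); try discriminate.
  exists k; split; [apply HP; now left|].
  intros k' Hk'; apply HP in Hk'; destruct Hk' as [->|[]]; auto.
Qed.

Lemma cardinal1_intro (P : Z -> Prop) (k : Z) :
  P k -> (forall k', P k' -> k' = k) -> cardinal 1 P.
Proof.
  intros Hk H; exists [k]; split; [|split]; auto.
  - repeat constructor; auto.
  - intros k'; split.
    + intros [->|[]]; auto.
    + intros Hk'; left; symmetry; auto.
Qed.

Lemma cardinal2_elim (P : Z -> Prop) :
  cardinal 2 P ->
  exists k1 k2, (k1 < k2)%Z /\ P k1 /\ P k2 /\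
    forall k', P k' -> k' = k1 \/ k' = k2.
Proof.
  intros ([|k1 [|k2 [|k3 L]]] & HL & Hn & HP); try discriminate.
  assert (H1 : P k1) by (apply HP; now left).
  assert (H2 : P k2) by (apply HP; right; now left).
  assert (H3 : forall k', P k' -> k' = k1 \/ k' = k2).
  { intros k' Hk'; apply HP in Hk'; destruct Hk' as [->|[->|[]]]; auto. }
  assert (k1 <> k2).
  { intros ->; inversion_clear HL as [|? ? Hn' _]; apply Hn'; now left. }
  destruct (Z.lt_total k1 k2) as [l|[l|l]]; [|lia|].
  - exists k1, k2; auto.
  - exists k2, k1; repeat split; auto.
    intros k' Hk'; destruct (H3 k' Hk'); auto.
Qed.

Lemma cardinal2_intro (P : Z -> Prop) (k1 k2 : Z) :
  k1 <> k2 -> P k1 -> P k2 -> (forall k', P k' -> k' = k1 \/ k' = k2) ->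
  cardinal 2 P.
Proof.
  intros Hne H1 H2 H; exists [k1; k2]; split; [|split]; auto.
  - constructor; [intros [->|[]]; auto|]; repeat constructor; auto.
  - intros k'; split.
    + intros [->|[->|[]]]; auto.
    + intros Hk'; destruct (H k' Hk') as [->| ->]; [left|right; left]; auto.
Qed.

Lemma sum_f_R0_indicator (g : nat -> R) (n : nat) :
  (forall i, g i = 0 \/ g i = 1) ->
  sum_f_R0 g n =
  INR (length (filter (fun i => if Req_dec_T (g i) 1 then true else false)
                 (seq 0 (S n)))).
Proof.
  intros Hg; induction n as [|n IH].
  - simpl; destruct (Req_dec_T (g 0%nat) 1); simpl; destruct (Hg 0%nat); lra.
  - rewrite tech5, IH, (seq_S (S n) 0), filter_app, length_app, plus_INR.
    f_equal; simpl.
    destruct (Req_dec_T (g (S n)) 1); simpl; destruct (Hg (S n)); lra.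
Qed.

(** The partial sum over [-M, M] is the length of [enum M], and once [M] bounds the support this
    list enumerates, without repetition, all indices of value 1. *)
Lemma zsum_cardinal (f : Z -> R) (n : nat) :
  (forall k, f k = 0 \/ f k = 1) ->
  zsum f (INR n) <-> cardinal n (fun k => f k = 1).
Proof.
  intros Hf.
  set (enum := fun M : nat =>
    map (fun i => (Z.of_nat i - Z.of_nat M)%Z)
      (filter (fun i => if Req_dec_T (f (Z.of_nat i - Z.of_nat M)%Z) 1
                        then true else false) (seq 0 (S (2 * M))))).
  assert (Hsum : forall M : nat,
    sum_f_R0 (fun i => f (Z.of_nat i - Z.of_nat M)%Z) (2 * M)
    = INR (length (enum M))).
  { intros M; unfold enum; rewrite length_map.
    apply (sum_f_R0_indicator (fun i => f (Z.of_nat i - Z.of_nat M)%Z)); auto. }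
  assert (Hnd : forall M, NoDup (enum M)).
  { intros M; apply Injective_map_NoDup; [intros u v; lia|].
    apply NoDup_filter, seq_NoDup. }
  assert (Hin : forall M : nat,
    (forall k, f k = 1 -> (Z.abs k <= Z.of_nat M)%Z) ->
    forall k, In k (enum M) <-> f k = 1).
  { intros M HM k; unfold enum; rewrite in_map_iff; split.
    - intros (i & <- & Hi); apply filter_In in Hi; destruct Hi as [_ Hi].
      destruct (Req_dec_T _ 1); easy.
    - intros Hk; exists (Z.to_nat (k + Z.of_nat M)).
      specialize (HM k Hk).
      assert (E : (Z.of_nat (Z.to_nat (k + Z.of_nat M)) - Z.of_nat M)%Z = k)
        by lia.
      split; auto.
      apply filter_In; split; [apply in_seq; lia|].
      rewrite E; destruct (Req_dec_T (f k) 1); easy. }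
  split.
  - intros (M & HM & Hs).
    exists (enum M); split; [auto|split].
    + apply INR_eq; rewrite <- Hsum; auto.
    + apply Hin; intros k Hk.
      destruct (Z_le_gt_dec (Z.abs k) (Z.of_nat M)); auto.
      rewrite HM in Hk by lia; lra.
  - intros (L & HL & Hn & HP).
    assert (exists M : nat, forall k, In k L -> (Z.abs k <= Z.of_nat M)%Z)
      as [M HM].
    { clear; induction L as [|k L [M IH]]; [exists O; easy|].
      exists (M + Z.to_nat (Z.abs k))%nat.
      intros j [->|Hj]; [lia|specialize (IH j Hj); lia]. }
    assert (HM' : forall k, f k = 1 -> (Z.abs k <= Z.of_nat M)%Z)
      by (intros k Hk; now apply HM, HP).
    exists M; split.
    + intros k Hk; destruct (Hf k) as [|H1]; auto.
      apply HM' in H1; lia.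
    + rewrite Hsum, <- Hn; f_equal.
      apply Nat.le_antisymm; apply NoDup_incl_length; auto;
        intros k Hk; [apply Hin, HP|apply HP, (Hin M)]; auto.
Qed.

Lemma chi_0_1 (l u t : R) : chi l u t = 0 \/ chi l u t = 1.
Proof.
  unfold chi; destruct (Rle_dec l t); [destruct (Rlt_dec t u)|]; auto.
Qed.

Lemma chi_1 (l u t : R) : chi l u t = 1 <-> l <= t < u.
Proof.
  unfold chi; destruct (Rle_dec l t); [destruct (Rlt_dec t u)|]; lra.
Qed.

Lemma chi_nonneg (l u t : R) : 0 <= chi l u t.
Proof. destruct (chi_0_1 l u t); lra. Qed.

(** * Solutions as boolean vectors and their translates *)

Section Solutions.
Variables a b c : R.

Definition window (t : R) (m k : Z) : Prop :=
  0 <= t - IZR m * a + IZR k * b < c.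

(** No value is prescribed at index 0, so that solutions can be translated freely; membership of [t]
    in S or D adds the condition [x 0 = true]. *)
Definition solution (n : nat) (t : R) (x : Z -> bool) : Prop :=
  forall m, cardinal n (fun k => window t m k /\ x k = true).

Lemma Mx_eq_const_solution (n : nat) (t : R) :
  (exists x, B0 x /\ Mx_eq_const a b c t x (INR n)) <->
  (exists x, x 0%Z = true /\ solution n t x).
Proof.
  split.
  - intros (x & (Hx & Hx0) & HM).
    exists (fun k => if Req_dec_T (x k) 1 then true else false); split.
    + now destruct (Req_dec_T (x 0%Z) 1).
    + intros m.
      assert (H01 : forall k, chi 0 c (t - IZR m * a + IZR k * b) * x k = 0 \/
                 chi 0 c (t - IZR m * a + IZR k * b) * x k = 1).
      { intros k; destruct (Hx k) as [-> | ->];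
          destruct (chi_0_1 0 c (t - IZR m * a + IZR k * b)); lra. }
      generalize (proj1 (zsum_cardinal _ n H01) (HM m)).
      apply cardinal_ext; intros k; unfold window.
      rewrite <- chi_1; destruct (Req_dec_T (x k) 1) as [E|E].
      * rewrite E; rewrite Rmult_1_r; tauto.
      * destruct (Hx k) as [->|]; [|easy].
        split; [lra|intros [_ H]; discriminate].
  - intros (x & Hx0 & HS).
    exists (fun k => if x k then 1 else 0); split; [split|].
    + intros k; destruct (x k); auto.
    + now rewrite Hx0.
    + intros m; apply zsum_cardinal.
      * intros k; destruct (x k);
          destruct (chi_0_1 0 c (t - IZR m * a + IZR k * b)); lra.
      * generalize (HS m); apply cardinal_ext; intros k; unfold window.
        rewrite <- chi_1; destruct (x k).
        -- rewrite Rmult_1_r; tauto.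
        -- split; [intros [_ H]; discriminate|lra].
Qed.

Lemma Sset_solution (t : R) :
  Sset a b c t <-> exists x, x 0%Z = true /\ solution 1 t x.
Proof. exact (Mx_eq_const_solution 1 t). Qed.

Lemma Dset_solution (t : R) :
  Dset a b c t <-> exists x, x 0%Z = true /\ solution 2 t x.
Proof.
  rewrite <- Mx_eq_const_solution; simpl; unfold Dset.
  now replace (1 + 1) with 2 by lra.
Qed.

(** Adding a multiple of [a] to [t] only renumbers the rows; in the next lemma a multiple of [b]
    renumbers the columns, and the vector with them. *)
Lemma solution_shift_a (n : nat) (t : R) (j : Z) (x : Z -> bool) :
  solution n t x -> solution n (t + IZR j * a) x.
Proof.
  intros H m; generalize (H (m - j)%Z); apply cardinal_ext; intros k.
  unfold window; rewrite minus_IZR.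
  replace (t - (IZR m - IZR j) * a + IZR k * b) with
    (t + IZR j * a - IZR m * a + IZR k * b) by ring; tauto.
Qed.

Lemma solution_shift_b (n : nat) (t : R) (j : Z) (x : Z -> bool) :
  solution n t x -> solution n (t + IZR j * b) (fun k => x (k + j)%Z).
Proof.
  intros H m; generalize (cardinal_shift _ _ j (H m)); apply cardinal_ext.
  intros k; unfold window; rewrite plus_IZR.
  replace (t - IZR m * a + (IZR k + IZR j) * b) with
    (t + IZR j * b - IZR m * a + IZR k * b) by ring; tauto.
Qed.

Lemma Sset_shift_a (t : R) (j : Z) : Sset a b c t -> Sset a b c (t + IZR j * a).
Proof.
  rewrite !Sset_solution; intros (x & Hx & H); exists x; split; auto.
  now apply solution_shift_a.
Qed.

(** With the converse below, S restricted to [t + bZ] records which indices occur in solutions at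
    [t]. *)
Lemma Sset_of_solution (t : R) (x : Z -> bool) (k : Z) :
  solution 1 t x -> x k = true -> Sset a b c (t + IZR k * b).
Proof.
  intros H Hk; apply Sset_solution.
  exists (fun i => x (i + k)%Z); split; [exact Hk|now apply solution_shift_b].
Qed.

Lemma solution_of_Sset (t : R) (k : Z) :
  Sset a b c (t + IZR k * b) -> exists x, x k = true /\ solution 1 t x.
Proof.
  rewrite Sset_solution; intros (x & Hx & H).
  exists (fun i => x (i + - k)%Z); split.
  - now replace (k + - k)%Z with 0%Z by lia.
  - replace t with (t + IZR k * b + IZR (- k) * b) by (rewrite opp_IZR; ring).
    now apply solution_shift_b.
Qed.

End Solutions.

(** * Residues modulo a and prefix parities *)

Lemma real_residue (a s : R) :
  0 < a -> exists (m : Z) (r : R), 0 <= r < a /\ s = r + IZR m * a.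
Proof.
  intros Ha; exists (Int_part (s / a)), (s - IZR (Int_part (s / a)) * a).
  destruct (base_Int_part (s / a)) as [H1 H2].
  assert (E : s = s / a * a) by (field; lra).
  split; [|ring].
  rewrite E at 1 3; split; nra.
Qed.

Lemma residue_unique (a r r' : R) (m m' : Z) :
  0 <= r < a -> 0 <= r' < a -> r + IZR m * a = r' + IZR m' * a ->
  m = m' /\ r = r'.
Proof.
  intros Hr Hr' E.
  assert (m = m') as <-.
  { destruct (Z.lt_total m m') as [l|[l|l]]; auto; exfalso;
      apply Zlt_le_succ, IZR_le in l; rewrite succ_IZR in l; nra. }
  split; auto; lra.
Qed.

Lemma IZR_mul_le (b : R) (i j : Z) : 0 < b -> (i <= j)%Z -> IZR i * b <= IZR j * b.
Proof. intros Hb H; apply IZR_le in H; nra. Qed.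

(** Elements of [x] between 0 and [k] are counted modulo 2: [pos] counts on [0, k) and [neg] on [k,
    0). The parity serves to separate a 2-solution into alternate elements. *)
Lemma exists_prefix_parity (x : Z -> bool) :
  exists par : Z -> bool, forall k, par (k + 1)%Z = xorb (par k) (x k).
Proof.
  set (pos := fix pos n := match n with
    | O => false | S n => xorb (pos n) (x (Z.of_nat n)) end).
  set (neg := fix neg n := match n with
    | O => false | S n => xorb (neg n) (x (- Z.of_nat (S n))%Z) end).
  exists (fun k => if (0 <=? k)%Z then pos (Z.to_nat k) else neg (Z.to_nat (- k))).
  intros k; destruct (Z.leb_spec 0 k) as [Hk|Hk].
  - destruct (Z.leb_spec 0 (k + 1)) as [Hk'|Hk']; [|lia].
    replace (Z.to_nat (k + 1)) with (S (Z.to_nat k)) by lia; simpl.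
    now rewrite Z2Nat.id.
  - assert (E : Z.to_nat (- k) = S (Z.to_nat (- (k + 1)))) by lia.
    rewrite E; cbn [neg].
    replace (- Z.of_nat (S (Z.to_nat (- (k + 1)))))%Z with k by lia.
    rewrite xorb_assoc, xorb_nilpotent, xorb_false_r.
    destruct (Z.leb_spec 0 (k + 1)) as [Hk'|Hk']; auto.
    now replace k with (-1)%Z by lia.
Qed.

Lemma parity_constant (x par : Z -> bool) (k : Z) (n : nat) :
  (forall i, par (i + 1)%Z = xorb (par i) (x i)) ->
  (forall i, (k <= i < k + Z.of_nat n)%Z -> x i = false) ->
  par (k + Z.of_nat n)%Z = par k.
Proof.
  intros Hp; induction n as [|n IH]; intros H.
  - f_equal; lia.
  - replace (k + Z.of_nat (S n))%Z with (k + Z.of_nat n + 1)%Z by lia.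
    rewrite Hp, H by lia; rewrite xorb_false_r.
    apply IH; intros i Hi; apply H; lia.
Qed.

(** * Gaps between consecutive elements of a 1-solution *)

Section Gaps.
Variables (a b c : R) (N : Z).
Hypotheses (Ha : 0 < a) (Hab : a < b) (HN : (1 <= N)%Z).
Hypotheses (Hc0 : b - a < c - IZR N * b) (Hc0' : c - IZR N * b < a).

(** Row [m] meets [x] only in [k], so a later element [k + i] has [r + i b >= c]. Row [m + 1] starts
    after [k] because [r < a], and its only element satisfies [r + i b < c + a]. With
    [c0 = c - N b], these bounds leave [i = N] and [r >= c0], or [i = N + 1] and
    [r < c0 + a - b]. *)
Lemma solution_gap (t r : R) (k m : Z) (x : Z -> bool) :
  solution a b c 1 t x -> x k = true ->
  0 <= r < a -> t + IZR k * b = r + IZR m * a ->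
  exists g, ((r < c - IZR N * b + a - b /\ g = (N + 1)%Z) \/
             (c - IZR N * b <= r /\ g = N)) /\
    x (k + g)%Z = true /\ forall i, (0 < i < g)%Z -> x (k + i)%Z = false.
Proof.
  intros Hx Hk Hr Et.
  destruct (cardinal1_elim _ (Hx m)) as (k0 & _ & U0).
  destruct (cardinal1_elim _ (Hx (m + 1)%Z)) as (k1 & [W1 X1] & _).
  unfold window in *; rewrite plus_IZR in W1.
  assert (Hk0 : k = k0).
  { apply U0; split; auto.
    assert (IZR 1 * b <= IZR N * b) by (apply IZR_mul_le; [lra|lia]).
    lra. }
  subst k0.
  assert (F0 : forall i, (0 < i)%Z -> r + IZR i * b < c -> x (k + i)%Z = false).
  { intros i Hi Hw; destruct (x (k + i)%Z) eqn:E; auto.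
    assert (k + i = k)%Z; [|lia].
    apply U0; split; auto; rewrite plus_IZR.
    assert (IZR 0 * b <= IZR i * b) by (apply IZR_mul_le; [lra|lia]).
    lra. }
  set (i := (k1 - k)%Z).
  assert (Ek1 : k1 = (k + i)%Z) by (unfold i; lia).
  rewrite Ek1 in *; clearbody i; clear Ek1 k1.
  rewrite plus_IZR in W1.
  assert (Hi1 : (1 <= i)%Z).
  { destruct (Z_le_gt_dec 1 i); auto.
    assert (IZR i * b <= IZR 0 * b) by (apply IZR_mul_le; [lra|lia]); lra. }
  assert (Hi2 : (i <= N + 1)%Z).
  { destruct (Z_le_gt_dec i (N + 1)); auto.
    assert (IZR (N + 2) * b <= IZR i * b) by (apply IZR_mul_le; [lra|lia]).
    rewrite plus_IZR in H; lra. }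
  assert (Hi3 : (N <= i)%Z).
  { destruct (Z_le_gt_dec N i); auto.
    assert (IZR i * b <= IZR (N - 1) * b) by (apply IZR_mul_le; [lra|lia]).
    rewrite minus_IZR in H.
    rewrite F0 in X1; [easy|lia|lra]. }
  destruct (Z.eq_dec i N) as [E|E].
  - subst i; exists N; split; [right; split; auto|split; auto].
    + destruct (Rle_lt_dec (c - IZR N * b) r); auto.
      rewrite F0 in X1; [easy|lia|lra].
    + intros i Hi; apply F0; [lia|].
      assert (IZR i * b <= IZR (N - 1) * b) by (apply IZR_mul_le; [lra|lia]).
      rewrite minus_IZR in H; lra.
  - assert (i = N + 1)%Z by lia; subst i.
    rewrite plus_IZR in W1.
    exists (N + 1)%Z; split; [left; split; auto; lra|split; auto].
    intros i Hi; apply F0; [lia|].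
    assert (IZR i * b <= IZR N * b) by (apply IZR_mul_le; [lra|lia]); lra.
Qed.

Lemma solution_last_before (t : R) (x : Z -> bool) (K : Z) :
  solution a b c 1 t x ->
  exists k, (k <= K)%Z /\ x k = true /\ forall i, (k < i <= K)%Z -> x i = false.
Proof.
  intros Hx.
  assert (exists k0, (k0 <= K)%Z /\ x k0 = true) as (k0 & Hk0 & X0).
  (* Rows of index below [v] see only columns at most [K], and every row meets [x]. *)
  { set (v := (IZR K * b - c + t) / a).
    destruct (archimed (- v)) as [Hv _].
    destruct (cardinal1_elim _ (Hx (- up (- v))%Z)) as (k & [Hw Hk] & _).
    exists k; split; auto.
    unfold window in Hw; rewrite opp_IZR in Hw.
    assert (v * a = IZR K * b - c + t) by (unfold v; field; lra).
    apply le_IZR; nra. }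
  assert (H : forall n k1, (k1 <= K)%Z -> (K - k1 < Z.of_nat n)%Z -> x k1 = true ->
    exists k, (k <= K)%Z /\ x k = true /\ forall i, (k < i <= K)%Z -> x i = false).
  { induction n as [|n IH]; intros k1 H1 H2 H3; [lia|].
    destruct (classic (exists i, (k1 < i <= K)%Z /\ x i = true))
      as [(i & Hi & Xi)|Hno].
    - apply (IH i); auto; lia.
    - exists k1; repeat split; auto; intros i Hi.
      destruct (x i) eqn:E; auto; exfalso; eauto. }
  apply (H (Z.to_nat (K - k0 + 1)) k0); auto; lia.
Qed.

(** The gap after a common element depends only on its residue, so both solutions jump to the same
    next element; [n] bounds the distance covered. *)
Lemma solution_agree_forward (t : R) (x y : Z -> bool) (n : nat) :
  solution a b c 1 t x -> solution a b c 1 t y ->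
  forall k, x k = true -> y k = true ->
  forall i, (k <= i < k + Z.of_nat n)%Z -> x i = y i.
Proof.
  intros Hx Hy; induction n as [|n IH]; intros k Xk Yk i Hi; [lia|].
  destruct (Z.eq_dec i k) as [->|Hne]; [congruence|].
  destruct (real_residue a (t + IZR k * b) Ha) as (m & r & Hr & E).
  destruct (solution_gap t r k m x Hx Xk Hr E) as (g & Hg & Xg & Fx).
  destruct (solution_gap t r k m y Hy Yk Hr E) as (g' & Hg' & Yg & Fy).
  assert (g' = g) by (destruct Hg as [[? ->]|[? ->]], Hg' as [[? ->]|[? ->]]; lra || lia).
  subst g'; assert (1 <= g)%Z by lia.
  destruct (Z_lt_le_dec i (k + g)).
  - replace i with (k + (i - k))%Z by lia; rewrite Fx, Fy; auto; lia.
  - apply (IH (k + g)%Z); auto; lia.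
Qed.

(** Predecessors [k - N] and [k - (N + 1)] exclude each other: their residues would satisfy
    [r >= c0] and [r' < c0 + a - b], while [r = r' + b - a] since the right side lies in [0, a);
    this gives [r < c0]. So the gap before [k] is determined too. *)
Lemma solution_agree_previous (t : R) (x y : Z -> bool) (k : Z) :
  solution a b c 1 t x -> solution a b c 1 t y ->
  x k = true -> y k = true ->
  exists p, (p < k)%Z /\ x p = true /\ y p = true.
Proof.
  intros Hx Hy Xk Yk.
  assert (Hprev : forall z, solution a b c 1 t z -> z k = true ->
    exists p r m, (p < k)%Z /\ z p = true /\ 0 <= r < a /\
      t + IZR p * b = r + IZR m * a /\
      ((r < c - IZR N * b + a - b /\ p = (k - (N + 1))%Z) \/
       (c - IZR N * b <= r /\ p = (k - N)%Z))).
  { intros z Hz Zk.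
    destruct (solution_last_before t z (k - 1) Hz) as (p & Hp & Zp & Hlast).
    destruct (real_residue a (t + IZR p * b) Ha) as (m & r & Hr & E).
    destruct (solution_gap t r p m z Hz Zp Hr E) as (g & Hg & Zg & Fz).
    exists p, r, m; repeat split; auto; try lra; try lia.
    assert (1 <= g)%Z by lia.
    assert (~ (p + g < k)%Z) by (intros H'; rewrite Hlast in Zg; [easy|lia]).
    assert (~ (k < p + g)%Z).
    { intros H'; specialize (Fz (k - p)%Z ltac:(lia)).
      replace (p + (k - p))%Z with k in Fz by lia; congruence. }
    destruct Hg as [[? ?]|[? ?]]; [left|right]; split; auto; lia. }
  destruct (Hprev x Hx Xk) as (p & r & m & Hp & Xp & Hr & E & Hc).
  destruct (Hprev y Hy Yk) as (p' & r' & m' & Hp' & Yp & Hr' & E' & Hc').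
  assert (Hnot : forall r r' m m', 0 <= r < a -> 0 <= r' < a ->
    t + IZR (k - N) * b = r + IZR m * a ->
    t + IZR (k - (N + 1)) * b = r' + IZR m' * a ->
    c - IZR N * b <= r -> r' < c - IZR N * b + a - b -> False).
  { clear - Ha Hab Hc0 Hc0'; intros r r' m m' Hr Hr' E E' H H'.
    rewrite minus_IZR in E, E'; rewrite plus_IZR in E'.
    destruct (residue_unique a r (r' + b - a) m (m' + 1)) as [_ U];
      try rewrite plus_IZR; lra. }
  exists p; repeat split; auto.
  enough (p = p') by congruence.
  destruct Hc as [[? ->]|[? ->]], Hc' as [[? ->]|[? ->]]; auto; exfalso; eauto.
Qed.

(** Common predecessors lead to a common element at or before [i], from which agreement propagates
    forward. *)
Lemma solution_determined (t : R) (x y : Z -> bool) (k : Z) :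
  solution a b c 1 t x -> solution a b c 1 t y ->
  x k = true -> y k = true -> forall i, x i = y i.
Proof.
  intros Hx Hy Xk Yk i.
  assert (H : forall n : nat, exists p, (p <= k - Z.of_nat n)%Z /\ x p = true /\ y p = true).
  { induction n as [|n (p & Hp & Xp & Yp)]; [exists k; repeat split; auto; lia|].
    destruct (solution_agree_previous t x y p) as (q & Hq & Xq & Yq); auto.
    exists q; repeat split; auto; lia. }
  destruct (H (Z.to_nat (k - i))) as (p & Hp & Xp & Yp).
  apply (solution_agree_forward t x y (Z.to_nat (i - p + 1)) Hx Hy p); auto; lia.
Qed.

Lemma solution_union (t : R) (x y : Z -> bool) :
  solution a b c 1 t x -> solution a b c 1 t y ->
  (forall k, x k = true -> y k = true -> False) ->
  solution a b c 2 t (fun k => x k || y k).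
Proof.
  intros Hx Hy Hd m.
  destruct (cardinal1_elim _ (Hx m)) as (k & [W X] & U).
  destruct (cardinal1_elim _ (Hy m)) as (k' & [W' Y'] & U').
  apply (cardinal2_intro _ k k').
  - intros ->; eauto.
  - now rewrite X.
  - rewrite Y', orb_true_r; auto.
  - intros i [Wi Hi]; apply orb_true_iff in Hi; destruct Hi; auto.
Qed.

(** Two solutions that differ are disjoint, and their union, recentred at one of its elements, would
    give a point of D. *)
Lemma solution_unique (t : R) (x y : Z -> bool) :
  (forall s, ~ Dset a b c s) ->
  solution a b c 1 t x -> solution a b c 1 t y -> forall i, x i = y i.
Proof.
  intros HD Hx Hy.
  destruct (classic (exists k, x k = true /\ y k = true)) as [(k & Xk & Yk)|Hno].
  - now apply (solution_determined t x y k).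
  - exfalso.
    destruct (cardinal1_elim _ (Hx 0%Z)) as (k & [_ X] & _).
    apply (HD (t + IZR k * b)), Dset_solution.
    exists (fun i => x (i + k)%Z || y (i + k)%Z); split.
    + now rewrite Z.add_0_l, X.
    + apply (solution_shift_b a b c 2 t k (fun i => x i || y i)).
      apply solution_union; auto; intros i Xi Yi; eauto.
Qed.

Lemma window_convex (t : R) (m k i k' : Z) :
  window a b c t m k -> window a b c t m k' -> (k <= i <= k')%Z ->
  window a b c t m i.
Proof.
  unfold window; intros H H' [Hi Hi'].
  apply (IZR_mul_le b) in Hi; [|lra]; apply (IZR_mul_le b) in Hi'; lra.
Qed.

(* Every window contains two consecutive elements of [x], hence one of each parity. *)
Lemma solution_split (t : R) (x : Z -> bool) :
  solution a b c 2 t x ->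
  exists y z, solution a b c 1 t y /\ solution a b c 1 t z /\
    forall k, y k = true -> z k = true -> False.
Proof.
  intros Hx; destruct (exists_prefix_parity x) as [par Hpar].
  assert (H : forall e : bool, solution a b c 1 t (fun k => x k && eqb (par k) e)).
  { intros e m; destruct (cardinal2_elim _ (Hx m))
      as (k1 & k2 & Hlt & [W1 X1] & [W2 X2] & U).
    assert (Hp : par k2 = negb (par k1)).
    { replace k2 with (k1 + 1 + Z.of_nat (Z.to_nat (k2 - k1 - 1)))%Z by lia.
      rewrite (parity_constant x par); [rewrite Hpar, X1; apply xorb_true_r|auto|].
      intros i Hi; destruct (x i) eqn:Xi; auto; exfalso.
      assert (W : window a b c t m i) by (apply (window_convex t m k1 i k2); auto; lia).
      destruct (U i (conj W Xi)); lia. }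
    destruct (eqb (par k1) e) eqn:E.
    - apply (cardinal1_intro _ k1); [rewrite X1, E; auto|].
      intros k [W H]; apply andb_true_iff in H; destruct H as [Xk Pk].
      destruct (U k (conj W Xk)) as [->| ->]; auto.
      rewrite Hp in Pk; destruct (par k1), e; discriminate.
    - apply (cardinal1_intro _ k2).
      + rewrite X2, Hp; split; auto; destruct (par k1), e; auto.
      + intros k [W H]; apply andb_true_iff in H; destruct H as [Xk Pk].
        destruct (U k (conj W Xk)) as [->| ->]; auto; congruence. }
  exists (fun k => x k && eqb (par k) true), (fun k => x k && eqb (par k) false).
  repeat split; auto.
  intros k H1 H2; destruct (x k), (par k); discriminate.
Qed.

(* [t] lies [j] steps of length [b] after the orbit point [r + m a], and no
   later orbit point is at or before [t]. *)
Definition tile (t : R) (j m : Z) (r : R) : Prop :=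
  t = r + IZR m * a + IZR j * b /\ 0 <= r < a /\ Sset a b c r /\ (0 <= j)%Z /\
  ((r < c - IZR N * b + a - b /\ (j <= N)%Z) \/ (c - IZR N * b <= r /\ (j < N)%Z)).

(** Take [-j] to be the last element at or before index 0: the next element lies beyond 0, so [j] is
    smaller than the gap after [-j]. *)
Lemma solution_tile (t : R) (x : Z -> bool) :
  solution a b c 1 t x -> exists j m r, x (- j)%Z = true /\ tile t j m r.
Proof.
  intros Hx.
  destruct (solution_last_before t x 0 Hx) as (k & Hk & Xk & Hlast).
  destruct (real_residue a (t + IZR k * b) Ha) as (m & r & Hr & E).
  destruct (solution_gap t r k m x Hx Xk Hr E) as (g & Hg & Xg & _).
  exists (- k)%Z, m, r.
  rewrite Z.opp_involutive; split; auto.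
  assert (0 < k + g)%Z.
  { destruct (Z_lt_le_dec 0 (k + g)); auto.
    rewrite Hlast in Xg; [easy|lia]. }
  repeat split; try lra; try lia.
  - rewrite opp_IZR; lra.
  - replace r with (t + IZR k * b + IZR (- m) * a) by (rewrite opp_IZR; lra).
    now apply Sset_shift_a, (Sset_of_solution a b c t x).
  - destruct Hg as [[? ?]|[? ?]]; [left|right]; split; auto; lia.
Qed.

(** As [j] is smaller than the gap, the solution through [-j] has no further element up to index
    0. *)
Lemma tile_solution (t r : R) (j m : Z) :
  tile t j m r ->
  exists x, solution a b c 1 t x /\ x (- j)%Z = true /\
    forall i, (- j < i <= 0)%Z -> x i = false.
Proof.
  intros (E & Hr & HS & Hj & Hc).
  apply (Sset_shift_a a b c r m) in HS.
  replace (r + IZR m * a) with (t + IZR (- j) * b) in HS by (rewrite opp_IZR; lra).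
  destruct (solution_of_Sset a b c t (- j) HS) as (x & Xj & Hx).
  exists x; repeat split; auto.
  destruct (solution_gap t r (- j) m x Hx Xj Hr) as (g & Hg & _ & F).
  { rewrite opp_IZR; lra. }
  intros i Hi; replace i with (- j + (i + j))%Z by lia; apply F.
  destruct Hg as [[? ->]|[? ->]], Hc as [[? ?]|[? ?]]; lra || lia.
Qed.

(** Both tiles come from the only solution at [t], and [-j] is its last element at or before 0; then
    [m] and [r] are a quotient and remainder modulo [a]. *)
Lemma tile_unique (t r r' : R) (j j' m m' : Z) :
  (forall s, ~ Dset a b c s) ->
  tile t j m r -> tile t j' m' r' -> j = j' /\ m = m' /\ r = r'.
Proof.
  intros HD T T'.
  destruct (tile_solution t r j m T) as (x & Hx & Xj & Fx).
  destruct (tile_solution t r' j' m' T') as (y & Hy & Yj & Fy).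
  pose proof (solution_unique t x y HD Hx Hy) as U.
  destruct T as (E & Hr & _ & Hj & _), T' as (E' & Hr' & _ & Hj' & _).
  assert (j = j') as <-.
  { destruct (Z.lt_total j j') as [l|[l|l]]; auto; exfalso.
    - rewrite U, Fy in Xj by lia; discriminate.
    - rewrite <- U, Fx in Yj by lia; discriminate. }
  split; auto; apply (residue_unique a); auto; lra.
Qed.

End Gaps.

(** * Compactness of the space of boolean vectors *)

Section Koenig.
Variables (I : Type) (rank : I -> nat).
Hypothesis rank_inj : forall i j, rank i = rank j -> i = j.
Variable A : nat -> (I -> bool) -> Prop.
Hypothesis A_nonempty : forall n, exists y, A n y.
Hypothesis A_decreasing : forall n y, A (S n) y -> A n y.

Let good (K : nat) (q : I -> bool) : Prop :=
  forall n, exists y, A n y /\ forall i, (rank i < K)%nat -> y i = q i.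

Let extend (K : nat) (q : I -> bool) (v : bool) (i : I) : bool :=
  if (rank i =? K)%nat then v else q i.

(** The greedy branch through good prefixes, preferring [true]. Only ranks below [K] are meaningful
    in [approx K]; the others hold the placeholder [false]. *)
Let approx : nat -> I -> bool := fix approx K :=
  match K with
  | O => fun _ => false
  | S K => extend K (approx K)
      (if excluded_middle_informative (good (S K) (extend K (approx K) true))
       then true else false)
  end.

Lemma decreasing_le (n m : nat) (y : I -> bool) : (n <= m)%nat -> A m y -> A n y.
Proof. induction 1; auto. Qed.

(** If the two extensions failed at levels [n1] and [n2], a member of [A (max n1 n2)] agreeing with
    [q] would lie in both [A n1] and [A n2], and its value at rank [K] would refute one of the
    failures. *)
Lemma good_extend (K : nat) (q : I -> bool) :
  good K q -> good (S K) (extend K q true) \/ good (S K) (extend K q false).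
Proof.
  intros G; apply NNPP; intros H; apply not_or_and in H; destruct H as [H1 H2].
  apply not_all_ex_not in H1; destruct H1 as [n1 H1].
  apply not_all_ex_not in H2; destruct H2 as [n2 H2].
  destruct (G (Nat.max n1 n2)) as (y & Ay & Hy).
  destruct (classic (exists i0, rank i0 = K /\ y i0 = false)) as [(i0 & R0 & Y0)|Hno].
  - apply H2; exists y; split; [apply (decreasing_le n2 _ y) in Ay; auto; lia|].
    intros i Hi; unfold extend; destruct (Nat.eqb_spec (rank i) K) as [E|E].
    + rewrite <- Y0; f_equal; apply rank_inj; congruence.
    + apply Hy; lia.
  - apply H1; exists y; split; [apply (decreasing_le n1 _ y) in Ay; auto; lia|].
    intros i Hi; unfold extend; destruct (Nat.eqb_spec (rank i) K) as [E|E].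
    + destruct (y i) eqn:Yi; auto; exfalso; eauto.
    + apply Hy; lia.
Qed.

Lemma good_approx (K : nat) : good K (approx K).
Proof.
  induction K as [|K IH].
  - intros n; destruct (A_nonempty n) as [y Ay]; exists y; split; auto; lia.
  - simpl; destruct (excluded_middle_informative _) as [G|G]; auto.
    destruct (good_extend K (approx K) IH); easy.
Qed.

Lemma approx_stable (K : nat) (i : I) :
  (rank i < K)%nat -> approx K i = approx (S (rank i)) i.
Proof.
  induction K as [|K IH]; intros H; [lia|].
  destruct (Nat.eq_dec (rank i) K) as [->|Hne]; auto.
  rewrite <- IH by lia; simpl; unfold extend at 1.
  now destruct (Nat.eqb_spec (rank i) K).
Qed.

(** The branch [x] is a common limit point of the sets [A n]; membership in them is not claimed,
    since they need not be closed. *)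
Lemma koenig :
  exists x, forall K n, exists y, A n y /\ forall i, (rank i < K)%nat -> y i = x i.
Proof.
  exists (fun i => approx (S (rank i)) i); intros K n.
  destruct (good_approx K n) as (y & Ay & Hy).
  exists y; split; auto; intros i Hi.
  rewrite Hy by auto; now apply approx_stable.
Qed.

End Koenig.

(** The enumeration 0, -1, 1, -2, 2, ... of Z. *)
Definition zrank (k : Z) : nat :=
  if (0 <=? k)%Z then Z.to_nat (2 * k) else Z.to_nat (- 2 * k - 1).

Lemma zrank_inj (i j : Z) : zrank i = zrank j -> i = j.
Proof.
  unfold zrank; destruct (Z.leb_spec 0 i), (Z.leb_spec 0 j); lia.
Qed.

Lemma zrank_lt (k : Z) (K : nat) :
  (Z.abs k <= Z.of_nat K)%Z -> (zrank k < 2 * K + 1)%nat.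
Proof. unfold zrank; destruct (Z.leb_spec 0 k); lia. Qed.

(** * Right limits of solutions and density of aZ + bZ *)

Section Limits.
Variables a b c : R.
Hypothesis Hb : 0 < b.

Lemma window_bounded (t : R) (m : Z) :
  exists K : nat, forall s k, t <= s < t + 1 -> window a b c s m k ->
    (Z.abs k <= Z.of_nat K)%Z.
Proof.
  set (v := (Rabs c + Rabs (t - IZR m * a) + 1) / b).
  assert (Ev : v * b = Rabs c + Rabs (t - IZR m * a) + 1) by (unfold v; field; lra).
  destruct (archimed v) as [Hv _].
  exists (Z.to_nat (up v)); intros s k Hs Hw; unfold window in Hw.
  pose proof (Rle_abs c); pose proof (Rle_abs (t - IZR m * a)).
  pose proof (Rle_abs (- (t - IZR m * a))) as H1; rewrite Rabs_Ropp in H1.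
  pose proof (Rabs_pos c).
  assert (IZR k <= v) by nra.
  assert (- v <= IZR k) by nra.
  assert (k < up v)%Z by (apply lt_IZR; lra).
  assert (- up v < k)%Z by (apply lt_IZR; rewrite opp_IZR; lra).
  lia.
Qed.

Lemma window_right_constant (t : R) (m k : Z) :
  exists d, 0 < d /\ forall s, t <= s < t + d ->
    (window a b c s m k <-> window a b c t m k).
Proof.
  unfold window; set (u := t - IZR m * a + IZR k * b).
  assert (E : forall s, s - IZR m * a + IZR k * b = u + (s - t))
    by (intros s; unfold u; ring).
  destruct (Rlt_le_dec u 0) as [H|H]; [|destruct (Rlt_le_dec u c) as [H'|H']].
  - exists (- u); split; [lra|]; intros s Hs; rewrite E; lra.
  - exists (c - u); split; [lra|]; intros s Hs; rewrite E; lra.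
  - exists 1; split; [lra|]; intros s Hs; rewrite E; lra.
Qed.

Lemma windows_right_constant (t : R) (m : Z) (K : nat) :
  exists d, 0 < d /\ forall s k, t <= s < t + d -> (Z.abs k <= Z.of_nat K)%Z ->
    (window a b c s m k <-> window a b c t m k).
Proof.
  induction K as [|K (d & Hd & IH)].
  - destruct (window_right_constant t m 0) as (d & Hd & H).
    exists d; split; auto; intros s k Hs Hk.
    assert (k = 0%Z) as -> by lia; auto.
  - destruct (window_right_constant t m (Z.of_nat (S K))) as (d1 & Hd1 & H1).
    destruct (window_right_constant t m (- Z.of_nat (S K))) as (d2 & Hd2 & H2).
    exists (Rmin d (Rmin d1 d2)); split; [repeat apply Rmin_glb_lt; auto|].
    intros s k Hs Hk.
    pose proof (Rmin_l d (Rmin d1 d2)); pose proof (Rmin_r d (Rmin d1 d2)).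
    pose proof (Rmin_l d1 d2); pose proof (Rmin_r d1 d2).
    destruct (Z_le_gt_dec (Z.abs k) (Z.of_nat K)); [apply IH; auto; lra|].
    destruct (Z_le_gt_dec 0 k).
    + replace k with (Z.of_nat (S K)) by lia; apply H1; lra.
    + replace k with (- Z.of_nat (S K))%Z by lia; apply H2; lra.
Qed.

(* The characteristic function of [0, c) is right-continuous and [{0,1}^Z] is
   compact. *)
Lemma solution_right_limit (n : nat) (t : R) (C : bool -> Prop) :
  (forall e, 0 < e -> exists s y, t <= s < t + e /\ solution a b c n s y /\ C (y 0%Z)) ->
  exists x, solution a b c n t x /\ C (x 0%Z).
Proof.
  intros H.
  set (A := fun (i : nat) (y : Z -> bool) =>
    exists s, t <= s < t + / INR (S i) /\ solution a b c n s y /\ C (y 0%Z)).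
  destruct (koenig Z zrank zrank_inj A) as [x Hx].
  - intros i; destruct (H (/ INR (S i))) as (s & y & Hs).
    + apply Rinv_0_lt_compat, lt_0_INR; lia.
    + exists y, s; auto.
  - intros i y (s & Hs & Hy); exists s; split; auto.
    assert (/ INR (S (S i)) <= / INR (S i)); [|lra].
    apply Rinv_le_contravar; [apply lt_0_INR; lia|apply le_INR; lia].
  - exists x; split.
    + intros m.
      destruct (window_bounded t m) as [K HK].
      destruct (windows_right_constant t m K) as (d & Hd & Hw).
      destruct (archimed_cor1 (Rmin d 1)) as (i & Hi & Hi0);
        [apply Rmin_glb_lt; lra|].
      pose proof (Rmin_l d 1); pose proof (Rmin_r d 1).
      (* At level [pred i] the point [s] is within [1 / i] of [t], so row [m] has the same columns
         at [s] and [t], all of rank below [2 K + 1], where [x] and [y] agree. *)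
      destruct (Hx (2 * K + 1)%nat (pred i)) as (y & (s & Hs & Hy & _) & Exy).
      replace (S (pred i)) with i in Hs by lia.
      generalize (Hy m); apply cardinal_ext; intros k; split; intros [W X].
      * assert (Z.abs k <= Z.of_nat K)%Z by (apply (HK s); auto; lra).
        rewrite <- Exy by (now apply zrank_lt); split; auto.
        apply Hw in W; auto; lra.
      * assert (Z.abs k <= Z.of_nat K)%Z by (apply (HK t); auto; lra).
        rewrite Exy by (now apply zrank_lt); split; auto.
        apply Hw; auto; lra.
    + destruct (Hx 1%nat 0%nat) as (y & (s & _ & _ & Hc) & Exy).
      rewrite <- Exy; auto; unfold zrank; simpl; lia.
Qed.

(** If the group [G = aZ + bZ] had no positive element below [e], it would have a least positive
    element [d] and equal [dZ]; then [a] and [b] would be integer multiples of [d], making [a / b]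
    rational. *)
Lemma integer_combinations_small (Ha : 0 < a) :
  (~ exists p q : Z, (q <> 0)%Z /\ a / b = IZR p / IZR q) ->
  forall e, 0 < e -> exists m n : Z, 0 < IZR m * a + IZR n * b < e.
Proof.
  intros Hirr e He; apply NNPP; intros Hno.
  set (G := fun g => exists m n : Z, g = IZR m * a + IZR n * b).
  assert (Gsub : forall g h, G g -> G h -> G (g - h)).
  { intros g h (m & n & ->) (m' & n' & ->).
    exists (m - m')%Z, (n - n')%Z; rewrite !minus_IZR; ring. }
  assert (Gmul : forall g i, G g -> G (IZR i * g)).
  { intros g i (m & n & ->); exists (i * m)%Z, (i * n)%Z; rewrite !mult_IZR; ring. }
  assert (Ga : G a) by (exists 1%Z, 0%Z; ring).
  assert (Gb : G b) by (exists 0%Z, 1%Z; ring).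
  assert (Hpos : forall g, G g -> 0 < g -> e <= g).
  { intros g (m & n & ->) Hg; destruct (Rle_lt_dec e (IZR m * a + IZR n * b)); auto.
    exfalso; eauto. }
  (* [completeness] supplies suprema, so [-v] is the infimum of the positive elements of [G]. *)
  destruct (completeness (fun y => exists g, G g /\ 0 < g /\ y = - g)) as [v [Hv1 Hv2]].
  { exists (- e); intros y (g & Gg & Hg & ->); specialize (Hpos g Gg Hg); lra. }
  { exists (- a), a; auto. }
  assert (Hve : e <= - v).
  { assert (v <= - e); [|lra].
    apply Hv2; intros y (g & Gg & Hg & ->); specialize (Hpos g Gg Hg); lra. }
  assert (Hlow : forall g, G g -> 0 < g -> - v <= g).
  { intros g Gg Hg; assert (- g <= v); [|lra]; apply Hv1; eauto. }
  (* A positive element within [e] of the infimum is least, because distinct elements of [G] differ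
     by at least [e]. *)
  assert (exists g, G g /\ 0 < g < - v + e) as (d & Gd & Hd).
  { apply NNPP; intros Hn.
    assert (v <= v - e); [|lra].
    apply Hv2; intros y (g & Gg & Hg & ->).
    destruct (Rle_lt_dec (- v + e) g); [lra|].
    exfalso; apply Hn; exists g; split; auto; lra. }
  assert (Hd' : forall g, G g -> 0 < g -> d <= g).
  { intros g Gg Hg; destruct (Rle_lt_dec d g) as [|Hlt]; auto.
    specialize (Hlow g Gg Hg).
    specialize (Hpos (d - g) (Gsub d g Gd Gg) ltac:(lra)); lra. }
  assert (Hdiv : forall g, G g -> exists i, g = IZR i * d).
  { intros g Gg; destruct (real_residue d g (proj1 Hd)) as (i & r & Hr & E).
    exists i; enough (r = 0) by lra.
    destruct (Req_dec r 0); auto.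
    assert (G r) by (replace r with (g - IZR i * d) by lra; auto).
    specialize (Hd' r H0 ltac:(lra)); lra. }
  destruct (Hdiv a Ga) as [p Ep]; destruct (Hdiv b Gb) as [q Eq].
  apply Hirr; exists p, q.
  assert (IZR q <> 0) by (intros Hq; rewrite Hq in Eq; lra).
  split; [intros ->; lra|].
  rewrite Ep, Eq; field; split; auto; lra.
Qed.

(** In the irrational case small combinations bring translates of [t0] arbitrarily close to [t] from
    the right, and right limits of solutions are solutions. In the rational case [a], [b], [c] are
    multiples of [d = b / q], so windows depend only on the cell [i d, (i + 1) d) containing [t],
    and a Bezout combination moves the cell of [t0] to that of [t]. *)
Lemma solution_exists_everywhere (Ha : 0 < a) (n : nat) :
  ((~ exists p q : Z, (q <> 0)%Z /\ a / b = IZR p / IZR q) \/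
   (exists p q : Z, (0 < p)%Z /\ (0 < q)%Z /\ Z.gcd p q = 1%Z /\
      a / b = IZR p / IZR q /\ exists k : Z, c / b = IZR k / IZR q)) ->
  (exists t x, solution a b c n t x) -> forall t, exists x, solution a b c n t x.
Proof.
  intros Hab (t0 & x0 & H0) t.
  assert (Hshift : forall i j, exists x, solution a b c n (t0 + IZR i * a + IZR j * b) x).
  { intros i j; eexists; apply solution_shift_b, solution_shift_a, H0. }
  destruct Hab as [Hirr|(p & q & Hp & Hq & Hpq & Ep & k & Ek)].
  - destruct (solution_right_limit n t (fun _ => True)) as (x & Hx & _); eauto.
    intros e He.
    destruct (integer_combinations_small Ha Hirr e He) as (i & j & Hij).
    set (g := IZR i * a + IZR j * b) in *.
    (* Subtracting [l] copies of [g] from [t0] lands in [t, t + g), inside [t, t + e). *)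
    destruct (real_residue g (t0 - t)) as (l & r & Hr & E); [lra|].
    destruct (Hshift (- l * i)%Z (- l * j)%Z) as [x Hx].
    exists (t + r), x; repeat split; auto; try lra.
    replace (t + r) with (t0 + IZR (- l * i) * a + IZR (- l * j) * b); auto.
    rewrite !mult_IZR, opp_IZR; unfold g in E; lra.
  - set (d := b / IZR q).
    assert (Hq' : 0 < IZR q) by (apply IZR_lt; lia).
    assert (Hd : 0 < d) by (apply Rdiv_lt_0_compat; auto).
    assert (Eb : b = IZR q * d) by (unfold d; field; lra).
    assert (Ea : a = IZR p * d).
    { replace a with (a / b * b) by (field; lra); rewrite Ep; unfold d; field; lra. }
    assert (Ec : c = IZR k * d).
    { replace c with (c / b * b) by (field; lra); rewrite Ek; unfold d; field; lra. }
    destruct (real_residue d t0 Hd) as (i0 & r0 & Hr0 & E0).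
    destruct (real_residue d t Hd) as (i & r & Hr & E).
    (* As [u a + v b = d], adding [i - i0] copies of this combination moves cell [i0] to cell
       [i]. *)
    destruct (Z.gcd_bezout p q 1 Hpq) as (u & v & Huv).
    destruct (Hshift ((i - i0) * u)%Z ((i - i0) * v)%Z) as [x Hx].
    exists x; intros m; generalize (Hx m); apply cardinal_ext; intros l.
    assert (W : forall r, 0 <= r < d ->
      (window a b c (r + IZR i * d) m l <-> (0 <= i - m * p + l * q < k)%Z)).
    { clear - Hd Ea Eb Ec; intros r Hr; unfold window.
      replace (r + IZR i * d - IZR m * a + IZR l * b)
        with (r + IZR (i - m * p + l * q) * d)
        by (rewrite plus_IZR, minus_IZR, !mult_IZR, Ea, Eb; ring).
      rewrite Ec; set (w := (i - m * p + l * q)%Z).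
      split; intros [H1 H2].
      - split.
        + apply Z.lt_succ_r, lt_IZR; rewrite succ_IZR; nra.
        + apply lt_IZR; nra.
      - assert (0 <= IZR w) by (apply IZR_le; lia).
        assert (IZR w + 1 <= IZR k) by (rewrite <- plus_IZR; apply IZR_le; lia).
        split; nra. }
    replace (t0 + IZR ((i - i0) * u) * a + IZR ((i - i0) * v) * b)
      with (r0 + IZR i * d).
    + rewrite E, (W r Hr), (W r0 Hr0); tauto.
    + rewrite E0, !mult_IZR, minus_IZR.
      assert (Huv' : IZR u * a + IZR v * b = d).
      { rewrite Ea, Eb; replace (IZR u * (IZR p * d) + IZR v * (IZR q * d))
          with (IZR (u * p + v * q) * d) by (rewrite plus_IZR, !mult_IZR; ring).
        rewrite Huv; lra. }
      transitivity (r0 + IZR i0 * d + (IZR i - IZR i0) * (IZR u * a + IZR v * b));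
        [rewrite Huv'|]; ring.
Qed.

End Limits.

(** * Sums over lists *)

Definition sumL {A : Type} (L : list A) (f : A -> R) : R :=
  fold_right (fun x s => f x + s) 0 L.

Lemma sumL_app {A : Type} (L L' : list A) (f : A -> R) :
  sumL (L ++ L') f = sumL L f + sumL L' f.
Proof. induction L as [|x L IH]; simpl; [|rewrite IH]; ring. Qed.

Lemma sumL_map {A B : Type} (g : A -> B) (L : list A) (f : B -> R) :
  sumL (map g L) f = sumL L (fun x => f (g x)).
Proof. induction L as [|x L IH]; simpl; [|rewrite IH]; auto. Qed.

Lemma sumL_le {A : Type} (L : list A) (f g : A -> R) :
  (forall x, In x L -> f x <= g x) -> sumL L f <= sumL L g.
Proof.
  induction L as [|x L IH]; simpl; intros H; [lra|].
  apply Rplus_le_compat; auto.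
Qed.

Lemma sumL_ext {A : Type} (L : list A) (f g : A -> R) :
  (forall x, In x L -> f x = g x) -> sumL L f = sumL L g.
Proof.
  intros H; apply Rle_antisym; apply sumL_le; intros x Hx; rewrite H; auto; lra.
Qed.

Lemma sumL_nonneg {A : Type} (L : list A) (f : A -> R) :
  (forall x, In x L -> 0 <= f x) -> 0 <= sumL L f.
Proof.
  induction L as [|x L IH]; simpl; intros H; [lra|].
  apply Rplus_le_le_0_compat; auto.
Qed.

Lemma sumL_ge_term {A : Type} (L : list A) (f : A -> R) (x : A) :
  (forall y, 0 <= f y) -> In x L -> f x <= sumL L f.
Proof.
  intros Hf; induction L as [|y L IH]; simpl; [easy|intros [->|Hx]].
  - assert (0 <= sumL L f) by (apply sumL_nonneg; auto); lra.
  - specialize (IH Hx); specialize (Hf y); lra.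
Qed.

Lemma sumL_ge_two_terms {A : Type} (L : list A) (f : A -> R) (x y : A) :
  (forall y, 0 <= f y) -> In x L -> In y L -> x <> y -> f x + f y <= sumL L f.
Proof.
  intros Hf; induction L as [|z L IH]; simpl; [easy|].
  intros [->|Hx] [->|Hy] Hne; [easy| | |].
  - pose proof (sumL_ge_term L f y Hf Hy); lra.
  - pose proof (sumL_ge_term L f x Hf Hx); lra.
  - specialize (IH Hx Hy Hne); specialize (Hf z); lra.
Qed.

Lemma sumL_nonzero {A : Type} (L : list A) (f : A -> R) :
  sumL L f <> 0 -> exists x, In x L /\ f x <> 0.
Proof.
  induction L as [|x L IH]; simpl; intros H; [easy|].
  destruct (Req_dec (f x) 0) as [E|E]; [|eauto].
  destruct IH as (y & Hy & Hfy); [lra|eauto].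
Qed.

Lemma sumL_le_one {A : Type} (L : list A) (f : A -> R) :
  NoDup L -> (forall x, In x L -> f x <= 1) ->
  (forall x y, In x L -> In y L -> f x <> 0 -> f y <> 0 -> x = y) ->
  sumL L f <= 1.
Proof.
  induction L as [|x L IH]; simpl; intros Hnd H1 HU; [lra|].
  inversion_clear Hnd as [|? ? Hx HL].
  destruct (Req_dec (f x) 0) as [E|E].
  - rewrite E, Rplus_0_l; apply IH; auto.
  - assert (sumL L f = 0) as ->; [|specialize (H1 x); rewrite Rplus_0_r; auto].
    apply NNPP; intros Hne; destruct (sumL_nonzero L f Hne) as (y & Hy & Hfy).
    rewrite (HU x y) in Hx; auto.
Qed.

Lemma sumL_seq_S (n : nat) (f : nat -> R) :
  sumL (seq 0 (S n)) f = sumL (seq 0 n) f + f n.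
Proof. rewrite seq_S, sumL_app; simpl; ring. Qed.

Lemma sumL_seq_const (n : nat) (v : R) : sumL (seq 0 n) (fun _ => v) = INR n * v.
Proof.
  induction n as [|n IH]; [simpl; ring|].
  rewrite sumL_seq_S, IH, S_INR; ring.
Qed.

Lemma sumL_seq_sum_f_R0 (n : nat) (f : nat -> R) :
  sumL (seq 0 (S n)) f = sum_f_R0 f n.
Proof.
  induction n as [|n IH]; [simpl; ring|].
  rewrite sumL_seq_S, IH; reflexivity.
Qed.

Lemma sumL_seq_mono (n m : nat) (f : nat -> R) :
  (forall i, 0 <= f i) -> (n <= m)%nat -> sumL (seq 0 n) f <= sumL (seq 0 m) f.
Proof.
  intros Hf; induction 1 as [|m _ IH]; [lra|].
  rewrite sumL_seq_S; specialize (Hf m); lra.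
Qed.

(** * Integrals of sums of indicator functions *)

(** Intervals are counted with multiplicity, so that the integral is the sum of the lengths even
    when intervals overlap. *)
Definition indicator (L : list (R * R)) (t : R) : R :=
  sumL L (fun p => chi (fst p) (snd p) t).

Definition total_length (L : list (R * R)) : R :=
  sumL L (fun p => snd p - fst p).

Lemma indicator_nonneg (L : list (R * R)) (t : R) : 0 <= indicator L t.
Proof. apply sumL_nonneg; intros; apply chi_nonneg. Qed.

(** [Rmax x (Rmin y u)] clamps [u] to [x, y]; the integrand is constant on each of the three pieces
    cut out by the clamped endpoints. *)
Lemma is_RInt_chi (l u x y : R) :
  l <= u -> x <= y ->
  is_RInt (chi l u) x y (Rmax x (Rmin y u) - Rmax x (Rmin y l)).
Proof.
  intros Hlu Hxy.
  set (l' := Rmax x (Rmin y l)); set (u' := Rmax x (Rmin y u)).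
  assert (Hl : x <= l' <= u' /\ u' <= y /\ (l' = x \/ l' <= l) /\ (l <= l' \/ l' = y)
     /\ (u' = x \/ u' <= u) /\ (u <= u' \/ u' = y)).
  { unfold l', u', Rmax, Rmin; repeat destruct (Rle_dec _ _); lra. }
  clearbody l' u'.
  assert (HC : forall v s t, s <= t -> (forall w, s < w < t -> chi l u w = v) ->
    is_RInt (chi l u) s t ((t - s) * v)).
  { intros v s t Hst Hv; apply (is_RInt_ext (fun _ => v)); [|apply (is_RInt_const s t v)].
    intros w Hw; rewrite Rmin_left, Rmax_right in Hw by auto; now rewrite Hv. }
  replace (u' - l') with ((l' - x) * 0 + ((u' - l') * 1 + (y - u') * 0)) by ring.
  apply (is_RInt_Chasles (chi l u) x l' y); [|apply (is_RInt_Chasles (chi l u) l' u' y)];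
    apply HC; try lra; intros w Hw; unfold chi;
    destruct (Rle_dec l w); try destruct (Rlt_dec w u); lra.
Qed.

Lemma is_RInt_sumL {A : Type} (L : list A) (f : A -> R -> R) (I : A -> R) (x y : R) :
  (forall p, In p L -> is_RInt (f p) x y (I p)) ->
  is_RInt (fun t => sumL L (fun p => f p t)) x y (sumL L I).
Proof.
  induction L as [|p L IH]; simpl; intros H.
  - evar_last; [apply (is_RInt_const x y 0)|apply Rmult_0_r].
  - apply (is_RInt_plus (f p) (fun t => sumL L (fun p => f p t))); auto.
Qed.

Lemma is_RInt_indicator (L : list (R * R)) (x y : R) :
  (forall p, In p L -> fst p <= snd p) -> x <= y ->
  is_RInt (indicator L) x y
    (sumL L (fun p => Rmax x (Rmin y (snd p)) - Rmax x (Rmin y (fst p)))).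
Proof.
  intros HL Hxy; apply (is_RInt_sumL L (fun p t => chi (fst p) (snd p) t)).
  intros p Hp; apply is_RInt_chi; auto.
Qed.

Lemma ex_RInt_indicator (L : list (R * R)) (x y : R) :
  (forall p, In p L -> fst p <= snd p) -> ex_RInt (indicator L) x y.
Proof.
  intros HL; destruct (Rle_dec x y) as [H|H].
  - eexists; now apply is_RInt_indicator.
  - apply ex_RInt_swap; eexists; apply is_RInt_indicator; auto; lra.
Qed.

Lemma RInt_indicator_le (L : list (R * R)) (x y : R) :
  (forall p, In p L -> fst p <= snd p) -> x <= y ->
  RInt (indicator L) x y <= total_length L.
Proof.
  intros HL Hxy; rewrite (is_RInt_unique _ _ _ _ (is_RInt_indicator L x y HL Hxy)).
  apply sumL_le; intros p Hp; specialize (HL p Hp).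
  unfold Rmax, Rmin; repeat destruct (Rle_dec _ _); lra.
Qed.

Lemma RInt_indicator_eq (L : list (R * R)) (x y : R) :
  (forall p, In p L -> x <= fst p <= snd p /\ snd p <= y) -> x <= y ->
  RInt (indicator L) x y = total_length L.
Proof.
  intros HL Hxy; rewrite (is_RInt_unique _ _ _ _ (is_RInt_indicator L x y ltac:(intros; apply HL; auto) Hxy)).
  apply sumL_ext; intros p Hp; specialize (HL p Hp).
  unfold Rmax, Rmin; repeat destruct (Rle_dec _ _); lra.
Qed.

(** * Periodization and counting of tiles *)

Section Tiling.
Variables (a b : R) (n M : nat).
Hypothesis Ha : 0 < a.

(** At points [t - j b] with [t] in [-a, 0] and [0 <= j <= n], and for [M] large, the shifts 0 to
    [M] are the only ones that can reach [0, a + 1]. *)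
Definition periodized (g : R -> R) (t : R) : R :=
  sumL (seq 0 (S M)) (fun m => g (t + INR m * a)).

(** For indicators of the two parts of S, with gaps [n + 1] and [n], this counts tiles at [t]: a
    nonzero term is a point [t - j b + m a] of S with [j] below its gap. *)
Definition tiling (g h : R -> R) (t : R) : R :=
  sumL (seq 0 (S n)) (fun j => periodized g (t - INR j * b)) +
  sumL (seq 0 n) (fun j => periodized h (t - INR j * b)).

Lemma is_RInt_translate (g : R -> R) (x y v I : R) :
  is_RInt g (x + v) (y + v) I -> is_RInt (fun t => g (t + v)) x y I.
Proof.
  intros H; apply (is_RInt_ext (fun t => scal 1 (g (1 * t + v)))).
  - intros t _; unfold scal; simpl; unfold mult; simpl; rewrite !Rmult_1_l; auto.
  - apply (is_RInt_comp_lin g 1 v); now rewrite !Rmult_1_l.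
Qed.

Lemma is_RInt_periodized (g : R -> R) (x : R) :
  (forall y z, ex_RInt g y z) ->
  is_RInt (periodized g) x (x + a) (RInt g x (x + INR (S M) * a)).
Proof.
  intros Hg; unfold periodized; generalize (S M) as K.
  induction K as [|K IH].
  - replace (x + INR 0 * a) with x by (simpl; ring); rewrite RInt_point.
    apply (is_RInt_sumL [] (fun (m : nat) t => g (t + INR m * a)) (fun _ => 0)); easy.
  - apply (is_RInt_ext (fun t => sumL (seq 0 K) (fun m => g (t + INR m * a))
        + g (t + INR K * a))).
    { intros t _; now rewrite sumL_seq_S. }
    rewrite S_INR, <- (RInt_Chasles g x (x + INR K * a)) by auto.
    apply (is_RInt_plus (fun t => sumL (seq 0 K) (fun m => g (t + INR m * a)))); auto.
    apply is_RInt_translate.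
    replace (x + a + INR K * a) with (x + (INR K + 1) * a) by ring.
    apply (RInt_correct g); auto.
Qed.

Lemma is_RInt_tiling (g h : R -> R) :
  (forall y z, ex_RInt g y z) -> (forall y z, ex_RInt h y z) ->
  is_RInt (tiling g h) (- a) 0
    (sumL (seq 0 (S n)) (fun j =>
       RInt g (- a - INR j * b) (- a - INR j * b + INR (S M) * a)) +
     sumL (seq 0 n) (fun j =>
       RInt h (- a - INR j * b) (- a - INR j * b + INR (S M) * a))).
Proof.
  intros Hg Hh.
  assert (H : forall f K, (forall y z, ex_RInt f y z) ->
    is_RInt (fun t => sumL (seq 0 K) (fun j => periodized f (t - INR j * b))) (- a) 0
      (sumL (seq 0 K) (fun j =>
       RInt f (- a - INR j * b) (- a - INR j * b + INR (S M) * a)))).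
  { intros f K Hf.
    apply (is_RInt_sumL (seq 0 K) (fun (j : nat) t => periodized f (t - INR j * b))).
    intros j _; apply is_RInt_translate.
    replace (0 + - (INR j * b)) with (- a - INR j * b + a) by ring.
    apply (is_RInt_periodized f (- a - INR j * b)); auto. }
  apply (is_RInt_plus (fun t => sumL (seq 0 (S n)) (fun j => periodized g (t - INR j * b))));
    auto.
Qed.

(** The integral over one period is at least [k a], and each of the [2 n + 1] translates contributes
    at most its total length to it. *)
Lemma tiling_ge_length (k : R) (L L' : list (R * R)) :
  (forall p, In p L -> fst p <= snd p) -> (forall p, In p L' -> fst p <= snd p) ->
  (forall t, - a <= t <= 0 -> k <= tiling (indicator L) (indicator L') t) ->
  k * a <= (INR n + 1) * total_length L + INR n * total_length L'.
Proof.
  intros HL HL' Hk.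
  assert (EL : forall y z, ex_RInt (indicator L) y z) by (intros; now apply ex_RInt_indicator).
  assert (EL' : forall y z, ex_RInt (indicator L') y z) by (intros; now apply ex_RInt_indicator).
  pose proof (is_RInt_tiling _ _ EL EL') as HI.
  apply Rle_trans with (RInt (tiling (indicator L) (indicator L')) (- a) 0).
  - replace (k * a) with (RInt (fun _ => k) (- a) 0)
      by (rewrite RInt_const; unfold scal; simpl; unfold mult; simpl; ring).
    apply RInt_le; [lra|apply ex_RInt_const|eexists; eauto|].
    intros t Ht; apply Hk; lra.
  - rewrite (is_RInt_unique _ _ _ _ HI).
    rewrite <- S_INR, <- (sumL_seq_const (S n)), <- (sumL_seq_const n).
    assert (0 <= INR (S M) * a) by (apply Rmult_le_pos; [apply pos_INR|lra]).
    apply Rplus_le_compat; apply sumL_le; intros j _; apply RInt_indicator_le; auto; lra.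
Qed.

(** The bound on [n b + w] makes every range [-a - j b, M a - j b] contain [0, w], so each translate
    contributes its full length to the integral over one period. *)
Lemma tiling_le_length (w : R) (L L' : list (R * R)) :
  0 < b -> INR n * b + w <= INR M * a ->
  (forall p, In p L -> 0 <= fst p <= snd p /\ snd p <= w) ->
  (forall p, In p L' -> 0 <= fst p <= snd p /\ snd p <= w) ->
  (forall t, - a < t < 0 -> tiling (indicator L) (indicator L') t <= 1) ->
  (INR n + 1) * total_length L + INR n * total_length L' <= a.
Proof.
  intros Hb HM HL HL' H1.
  assert (EL : forall y z, ex_RInt (indicator L) y z)
    by (intros; apply ex_RInt_indicator; intros; now apply HL).
  assert (EL' : forall y z, ex_RInt (indicator L') y z)
    by (intros; apply ex_RInt_indicator; intros; now apply HL').
  pose proof (is_RInt_tiling _ _ EL EL') as HI.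
  apply Rle_trans with (RInt (tiling (indicator L) (indicator L')) (- a) 0).
  - rewrite (is_RInt_unique _ _ _ _ HI).
    rewrite <- S_INR, <- (sumL_seq_const (S n)), <- (sumL_seq_const n).
    assert (Hj : forall j, (j <= n)%nat -> 0 <= INR j * b <= INR n * b).
    { intros j Hj; apply le_INR in Hj; pose proof (pos_INR j); nra. }
    pose proof (pos_INR M).
    apply Rplus_le_compat; apply sumL_le; intros j Hjn; apply in_seq in Hjn;
      specialize (Hj j ltac:(lia)); rewrite RInt_indicator_eq; try lra;
      try (rewrite S_INR; nra);
      intros p Hp; [specialize (HL p Hp)|specialize (HL' p Hp)]; rewrite S_INR; lra.
  - replace a with (RInt (fun _ => 1) (- a) 0) at 2
      by (rewrite RInt_const; unfold scal; simpl; unfold mult; simpl; ring).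
    apply RInt_le; [lra|eexists; eauto|apply ex_RInt_const|].
    intros t Ht; apply H1; lra.
Qed.

Lemma periodized_nonneg (g : R -> R) (t : R) :
  (forall s, 0 <= g s) -> 0 <= periodized g t.
Proof. intros Hg; apply sumL_nonneg; auto. Qed.

Lemma periodized_ge_term (g : R -> R) (t : R) (m : nat) :
  (forall s, 0 <= g s) -> (m <= M)%nat -> g (t + INR m * a) <= periodized g t.
Proof.
  intros Hg Hm; apply (sumL_ge_term _ (fun m => g (t + INR m * a))); auto.
  apply in_seq; lia.
Qed.

Lemma tiling_mono (g g' h h' : R -> R) (t : R) :
  (forall s, g s <= g' s) -> (forall s, h s <= h' s) ->
  tiling g h t <= tiling g' h' t.
Proof.
  intros Hg Hh; apply Rplus_le_compat; apply sumL_le; intros j _; apply sumL_le; auto.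
Qed.

End Tiling.

(** * Coverings by half-open intervals *)

(** [P] may fail at the supremum [s] of the reachable points, so the step starts from some [z] in (s
    - d, s] satisfying [P] and must pass beyond [s]. *)
Lemma real_induction (x y : R) (P : R -> Prop) :
  x <= y -> P x ->
  (forall s, x <= s <= y -> exists d w, 0 < d /\ s < w /\
     forall z, x <= z <= s -> s - d < z -> P z -> P w) ->
  exists w, y < w /\ P w.
Proof.
  intros Hxy Hx Hstep; apply NNPP; intros Hno.
  destruct (completeness (fun z => x <= z /\ P z)) as [s [Hs1 Hs2]].
  { exists y; intros z [Hz Pz]; destruct (Rle_lt_dec z y); auto; exfalso; eauto. }
  { exists x; split; auto; lra. }
  assert (x <= s) by (apply Hs1; split; auto; lra).
  assert (s <= y).
  { apply Hs2; intros z [Hz Pz]; destruct (Rle_lt_dec z y); auto; exfalso; eauto. }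
  destruct (Hstep s) as (d & w & Hd & Hw & H'); auto.
  assert (exists z, x <= z /\ P z /\ s - d < z) as (z & Hz & Pz & Hdz).
  { apply NNPP; intros Hn; assert (s <= s - d); [|lra].
    apply Hs2; intros z [Hz Pz]; destruct (Rle_lt_dec z (s - d)); auto; exfalso; eauto. }
  assert (z <= s) by (apply Hs1; auto).
  assert (w <= s); [|lra].
  apply Hs1; split; [lra|]; apply (H' z); auto.
Qed.

(** Compactness of [x, y]: as [Q] grows with [K], finitely many local indices can be replaced by
    their maximum. *)
Lemma uniform_index (x y : R) (Q : nat -> R -> Prop) :
  x <= y -> (forall K K' t, (K <= K')%nat -> Q K t -> Q K' t) ->
  (forall s, x <= s <= y ->
     exists d K, 0 < d /\ forall t, Rabs (t - s) < d -> Q K t) ->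
  exists K, forall t, x <= t <= y -> Q K t.
Proof.
  intros Hxy Hmono Hloc.
  destruct (real_induction x y (fun z => exists K, forall t, x <= t <= z -> Q K t))
    as (w & Hw & K & HK); auto.
  - destruct (Hloc x) as (d & K & Hd & H); [lra|].
    exists K; intros t Ht; apply H; apply Rabs_def1; lra.
  - intros s Hs; destruct (Hloc s Hs) as (d & K & Hd & H).
    exists d, (s + d / 2); repeat split; try lra.
    intros z Hz Hdz (K' & HK').
    exists (Nat.max K K'); intros t Ht; destruct (Rle_lt_dec t z).
    + apply (Hmono K'); [lia|apply HK'; lra].
    + apply (Hmono K); [lia|apply H; apply Rabs_def1; lra].
  - exists K; intros t Ht; apply HK; lra.
Qed.

(** A lower bound for [g] at the single point [s] becomes a lower bound for [g'] near [s], the local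
    form that compactness needs. *)
Definition dominated (g g' : R -> R) : Prop :=
  forall s, exists d, 0 < d /\ forall t, Rabs (t - s) < d -> g s <= g' t.

Lemma dominated_plus (g g' h h' : R -> R) :
  dominated g g' -> dominated h h' ->
  dominated (fun t => g t + h t) (fun t => g' t + h' t).
Proof.
  intros Hg Hh s; destruct (Hg s) as (d & Hd & H), (Hh s) as (d' & Hd' & H').
  exists (Rmin d d'); split; [now apply Rmin_glb_lt|]; intros t Ht.
  pose proof (Rmin_l d d'); pose proof (Rmin_r d d').
  apply Rplus_le_compat; [apply H|apply H']; lra.
Qed.

Lemma dominated_sumL {A : Type} (L : list A) (f f' : A -> R -> R) :
  (forall x, dominated (f x) (f' x)) ->
  dominated (fun t => sumL L (fun x => f x t)) (fun t => sumL L (fun x => f' x t)).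
Proof.
  intros H; induction L as [|x L IH]; simpl.
  - intros s; exists 1; split; intros; lra.
  - apply (dominated_plus (f x) (f' x)); auto.
Qed.

Lemma dominated_translate (g g' : R -> R) (v : R) :
  dominated g g' -> dominated (fun t => g (t + v)) (fun t => g' (t + v)).
Proof.
  intros Hg s; destruct (Hg (s + v)) as (d & Hd & H).
  exists d; split; auto; intros t Ht; apply H.
  now replace (t + v - (s + v)) with (t - s) by ring.
Qed.

(** [l, u) lies in the interior of [l - e, u). *)
Lemma dominated_chi (l u e : R) : 0 < e -> dominated (chi l u) (chi (l - e) u).
Proof.
  intros He s; destruct (chi_0_1 l u s) as [->|E].
  - exists 1; split; [lra|]; intros; apply chi_nonneg.
  - rewrite E; apply chi_1 in E.
    exists (Rmin e (u - s)); split; [apply Rmin_glb_lt; lra|]; intros t Ht.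
    pose proof (Rmin_l e (u - s)); pose proof (Rmin_r e (u - s)).
    apply Rabs_def2 in Ht; right; symmetry; apply chi_1; lra.
Qed.

Lemma dominated_tiling (a b : R) (n M : nat) (g g' h h' : R -> R) :
  dominated g g' -> dominated h h' ->
  dominated (tiling a b n M g h) (tiling a b n M g' h').
Proof.
  assert (H : forall K f f', dominated f f' ->
    dominated (fun t => sumL (seq 0 K) (fun j => periodized a M f (t - INR j * b)))
      (fun t => sumL (seq 0 K) (fun j => periodized a M f' (t - INR j * b)))).
  { intros K f f' Hf.
    apply (dominated_sumL _ (fun (j : nat) t => periodized a M f (t - INR j * b))
      (fun (j : nat) t => periodized a M f' (t - INR j * b))).
    intros j; apply (dominated_translate (periodized a M f) (periodized a M f')).
    apply (dominated_sumL _ (fun (m : nat) t => f (t + INR m * a))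
      (fun (m : nat) t => f' (t + INR m * a))).
    intros m; now apply dominated_translate. }
  intros Hg Hh; apply dominated_plus; now apply H.
Qed.

Definition intervals (l u : nat -> R) (K : nat) : list (R * R) :=
  map (fun i => (l i, u i)) (seq 0 K).

Lemma indicator_intervals (l u : nat -> R) (K : nat) (t : R) :
  indicator (intervals l u K) t = sumL (seq 0 K) (fun i => chi (l i) (u i) t).
Proof. unfold indicator, intervals; now rewrite sumL_map. Qed.

Lemma indicator_intervals_mono (l u : nat -> R) (K K' : nat) (t : R) :
  (K <= K')%nat -> indicator (intervals l u K) t <= indicator (intervals l u K') t.
Proof.
  intros H; rewrite !indicator_intervals; apply sumL_seq_mono; auto.
  intros; apply chi_nonneg.
Qed.

Lemma finite_subcover (E : R -> Prop) (l u : nat -> R) (A : list R) :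
  (forall t, E t -> exists i, l i <= t < u i) -> (forall p, In p A -> E p) ->
  exists K, forall p, In p A -> 1 <= indicator (intervals l u K) p.
Proof.
  intros HE; induction A as [|p A IH]; intros HA; [exists O; easy|].
  destruct IH as [K HK]; [intros; apply HA; now right|].
  destruct (HE p) as [i Hi]; [apply HA; now left|].
  exists (Nat.max K (S i)); intros q [->|Hq].
  - rewrite indicator_intervals, <- (proj2 (chi_1 (l i) (u i) q) Hi).
    apply (sumL_ge_term _ (fun i => chi (l i) (u i) q)).
    + intros; apply chi_nonneg.
    + apply in_seq; lia.
  - apply Rle_trans with (indicator (intervals l u K) q); auto.
    apply indicator_intervals_mono; lia.
Qed.

(** The enlargements [e / 2 ^ (i + 1)] add up to less than [e]. *)
Lemma total_length_enlarged (l u : nat -> R) (s e : R) (K : nat) :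
  0 < e -> (forall i, l i <= u i) -> infinite_sum (fun i => u i - l i) s ->
  total_length (intervals (fun i => l i - e * (/ 2) ^ S i) u K) <= s + e.
Proof.
  intros He Hlu Hs; unfold total_length, intervals; rewrite sumL_map; simpl.
  assert (H : forall K, sumL (seq 0 K) (fun i => u i - (l i - e * (/ 2 * (/ 2) ^ i)))
    = sumL (seq 0 K) (fun i => u i - l i) + e * (1 - (/ 2) ^ K)).
  { clear; induction K as [|K IH]; [simpl; ring|].
    rewrite !sumL_seq_S, IH; simpl; field. }
  rewrite H.
  assert (0 < (/ 2) ^ K) by (apply pow_lt; lra).
  assert (sumL (seq 0 K) (fun i => u i - l i) <= s); [|nra].
  apply Rle_trans with (sumL (seq 0 (S K)) (fun i => u i - l i)).
  - apply sumL_seq_mono; [|lia]; intros i; specialize (Hlu i); lra.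
  - rewrite sumL_seq_sum_f_R0; apply sum_incr; [exact Hs|].
    intros i; specialize (Hlu i); lra.
Qed.

(* If every [t] is covered [k] times as soon as [g >= 1] and [h >= 1] at finitely
   many points of [E] and [E'], then so it is by every covering of [E] and [E']. *)
Lemma cover_tiling_ge (a b : R) (n M : nat) (k s s' : R) (E E' : R -> Prop) :
  0 < a -> cover_sum E s -> cover_sum E' s' ->
  (forall t, - a <= t <= 0 -> exists A A',
     (forall p, In p A -> E p) /\ (forall p, In p A' -> E' p) /\
     forall g h, (forall r, 0 <= g r) -> (forall r, 0 <= h r) ->
       (forall p, In p A -> 1 <= g p) -> (forall p, In p A' -> 1 <= h p) ->
       k <= tiling a b n M g h t) ->
  k * a <= (INR n + 1) * s + INR n * s'.
Proof.
  intros Ha (l & u & Hlu & HE & Hs) (l' & u' & Hlu' & HE' & Hs') H.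
  apply Rle_plus_epsilon; intros eps Heps.
  pose proof (pos_INR n).
  (* The coverings enter with weights [n + 1] and [n], so lengthening each by [e] costs [eps] in
     all. *)
  set (e := eps / (2 * INR n + 1)).
  assert (He : 0 < e) by (apply Rdiv_lt_0_compat; lra).
  set (L := intervals (fun i => l i - e * (/ 2) ^ S i) u).
  set (L' := intervals (fun i => l' i - e * (/ 2) ^ S i) u').
  assert (Hpow : forall i, 0 < e * (/ 2) ^ S i)
    by (intros i; apply Rmult_lt_0_compat; [lra|apply pow_lt; lra]).
  assert (Hdom : forall (l u : nat -> R) K, dominated (indicator (intervals l u K))
    (indicator (intervals (fun i => l i - e * (/ 2) ^ S i) u K))).
  { intros l1 u1 K t.
    destruct (dominated_sumL (seq 0 K) (fun i => chi (l1 i) (u1 i))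
      (fun i => chi (l1 i - e * (/ 2) ^ S i) (u1 i))
      (fun i => dominated_chi _ _ _ (Hpow i)) t) as (d & Hd & Hd').
    exists d; split; auto; intros t' Ht'; rewrite !indicator_intervals; auto. }
  destruct (uniform_index (- a) 0
    (fun K t => k <= tiling a b n M (indicator (L K)) (indicator (L' K)) t)) as [K HK].
  - lra.
  - intros K K' t HK Hk; eapply Rle_trans; [exact Hk|].
    apply tiling_mono; intros; now apply indicator_intervals_mono.
  - intros t Ht; destruct (H t Ht) as (A & A' & HA & HA' & Hg).
    destruct (finite_subcover E l u A HE HA) as [K1 HK1].
    destruct (finite_subcover E' l' u' A' HE' HA') as [K2 HK2].
    (* Finitely many intervals already give the bound at [t]; the enlarged ones keep it on a
       neighbourhood. *)
    destruct (dominated_tiling a b n M _ _ _ _ (Hdom l u (Nat.max K1 K2))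
      (Hdom l' u' (Nat.max K1 K2)) t) as (d & Hd & Hd').
    exists d, (Nat.max K1 K2); split; auto; intros t' Ht'.
    eapply Rle_trans; [|apply Hd'; auto].
    apply Hg; [intros; apply indicator_nonneg|intros; apply indicator_nonneg| |].
    + intros p Hp; eapply Rle_trans; [apply (HK1 p Hp)|apply indicator_intervals_mono; lia].
    + intros p Hp; eapply Rle_trans; [apply (HK2 p Hp)|apply indicator_intervals_mono; lia].
  - assert (HL : forall (l u : nat -> R), (forall i, l i <= u i) ->
      forall p, In p (intervals (fun i => l i - e * (/ 2) ^ S i) u K) -> fst p <= snd p).
    { intros l1 u1 H1 p Hp; apply in_map_iff in Hp; destruct Hp as (i & <- & _); cbn [fst snd].
      specialize (H1 i); specialize (Hpow i); lra. }
    pose proof (tiling_ge_length a b n M Ha k (L K) (L' K) (HL l u Hlu) (HL l' u' Hlu') HK).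
    pose proof (total_length_enlarged l u s e K He Hlu Hs : total_length (L K) <= s + e).
    pose proof (total_length_enlarged l' u' s' e K He Hlu' Hs'
      : total_length (L' K) <= s' + e).
    assert ((2 * INR n + 1) * e = eps) by (unfold e; field; lra).
    nra.
Qed.

Lemma sumL_nth (L : list (R * R)) (f : R * R -> R) (d : R * R) (K : nat) :
  f d = 0 -> (length L <= K)%nat ->
  sumL (seq 0 K) (fun i => f (nth i L d)) = sumL L f.
Proof.
  intros Hd; revert K; induction L as [|p L IH]; intros K HK.
  - rewrite (sumL_ext _ _ (fun _ => 0)); [rewrite sumL_seq_const; simpl; ring|].
    intros [|i] _; auto.
  - destruct K as [|K]; simpl in HK; [lia|]; simpl.
    rewrite <- seq_shift, sumL_map; simpl; rewrite IH by lia; auto.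
Qed.

Lemma cover_sum_list (E : R -> Prop) (L : list (R * R)) :
  (forall p, In p L -> fst p <= snd p) ->
  (forall t, E t -> exists p, In p L /\ fst p <= t < snd p) ->
  cover_sum E (total_length L).
Proof.
  intros HL HE.
  (* The empty interval [0, 0) pads the list to a sequence. *)
  exists (fun i => fst (nth i L (0, 0))), (fun i => snd (nth i L (0, 0))).
  split; [|split].
  - intros i; destruct (nth_in_or_default i L (0, 0)) as [H| ->]; [auto|simpl; lra].
  - intros t Ht; destruct (HE t Ht) as (p & Hp & Hpt).
    destruct (In_nth L p (0, 0) Hp) as (i & _ & <-); eauto.
  - intros eps Heps; exists (length L); intros i Hi.
    rewrite <- sumL_seq_sum_f_R0.
    rewrite (sumL_nth L (fun p => snd p - fst p)) by (simpl; lra || lia).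
    unfold total_length; now rewrite R_dist_eq.
Qed.

(** * Sets that are locally constant to the right *)

Definition right_constant (P : R -> Prop) : Prop :=
  forall s, exists d, 0 < d /\
    ((forall t, s <= t < s + d -> P t) \/ (forall t, s <= t < s + d -> ~ P t)).

Lemma right_constant_and (P Q : R -> Prop) :
  right_constant P -> right_constant Q -> right_constant (fun t => P t /\ Q t).
Proof.
  intros HP HQ s; destruct (HP s) as (d & Hd & H), (HQ s) as (d' & Hd' & H').
  pose proof (Rmin_l d d'); pose proof (Rmin_r d d').
  exists (Rmin d d'); split; [now apply Rmin_glb_lt|].
  destruct H as [H|H].
  - destruct H' as [H'|H'].
    + left; intros t Ht; split; [apply H|apply H']; lra.
    + right; intros t Ht [_ Qt]; apply (H' t); auto; lra.
  - right; intros t Ht [Pt _]; apply (H t); auto; lra.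
Qed.

Lemma right_constant_interval (l u : R) : right_constant (fun t => l <= t < u).
Proof.
  intros s; destruct (Rlt_le_dec s l) as [H|H]; [|destruct (Rlt_le_dec s u) as [H'|H']].
  - exists (l - s); split; [lra|right; intros; lra].
  - exists (u - s); split; [lra|left; intros; lra].
  - exists 1; split; [lra|right; intros; lra].
Qed.

(* [A] consists of disjoint intervals inside [P]; [B] collects the short pieces
   to the left of the points where [P] need not have a left limit. *)
Lemma right_constant_approx (P : R -> Prop) (x y e : R) :
  x <= y -> 0 < e -> right_constant P ->
  exists A B : list (R * R),
    (forall p, In p (A ++ B) -> x <= fst p <= snd p /\ snd p <= y + 1) /\
    (forall t, indicator A t <= 1 /\ (indicator A t <> 0 -> P t)) /\
    (forall t, x <= t <= y -> P t -> exists p, In p (A ++ B) /\ fst p <= t < snd p) /\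
    total_length B <= e * (y + 1 - x).
Proof.
  intros Hxy He HP.
  destruct (real_induction x y (fun z => z <= y + 1 /\ exists A B : list (R * R),
    (forall p, In p (A ++ B) -> x <= fst p <= snd p /\ snd p <= z) /\
    (forall t, indicator A t <= 1 /\ (indicator A t <> 0 -> P t)) /\
    (forall t, x <= t < z -> P t -> exists p, In p (A ++ B) /\ fst p <= t < snd p) /\
    total_length B <= e * (z - x))) as (w & Hw & Hw1 & A & B & H1 & H2 & H3 & H4); auto.
  - split; [lra|]; exists [], []; repeat split; try easy.
    + unfold indicator; simpl; lra.
    + intros t Ht; lra.
    + unfold total_length; simpl; lra.
  - intros s Hs; destruct (HP s) as (d & Hd & Hc).
    pose proof (Rmin_l d 1); pose proof (Rmin_r d 1).
    assert (0 < Rmin d 1) by (apply Rmin_glb_lt; lra).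
    set (w := s + Rmin d 1).
    (* The piece [z, s) put into [B] is shorter than [e] times the advance [w - s], which preserves
       the bound on [total_length B]; the minimum with 1 keeps [w] at most [y + 1]. *)
    exists (e * Rmin d 1), w; split; [apply Rmult_lt_0_compat; lra|split; [unfold w; lra|]].
    intros z Hz Hzs (_ & A & B & H1' & H2 & H3 & H4); split; [unfold w; lra|].
    assert (Hin : forall t, indicator A t <> 0 -> t < z).
    { intros t Ht; apply sumL_nonzero in Ht; destruct Ht as (p & Hp & Hne).
      destruct (chi_0_1 (fst p) (snd p) t) as [|Ht]; [easy|apply chi_1 in Ht].
      destruct (H1' p); [apply in_or_app; now left|lra]. }
    assert (HB : total_length ((z, s) :: B) <= e * (w - x)).
    { unfold total_length in *; simpl; unfold w; nra. }
    assert (Hzs' : x <= z <= s /\ s <= w) by (unfold w; lra).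
    assert (Hb : forall p, In p (A ++ B) -> x <= fst p <= snd p /\ snd p <= w).
    { intros p Hp; destruct (H1' p Hp); lra. }
    assert (Hcov : forall t, x <= t < s -> P t ->
      exists p, In p (A ++ (z, s) :: B) /\ fst p <= t < snd p).
    { intros t Ht Pt; destruct (Rlt_le_dec t z).
      - destruct (H3 t) as (p & Hp & Hpt); auto; [lra|].
        exists p; split; auto; apply in_app_or in Hp; apply in_or_app; simpl; tauto.
      - exists (z, s); split; [apply in_or_app; right; now left|simpl; lra]. }
    destruct Hc as [Hc|Hc].
    + exists ((s, w) :: A), ((z, s) :: B); split; [|split; [|split; [|exact HB]]].
      * intros p Hp; apply in_app_or in Hp.
        destruct Hp as [[<-|Hp]|[<-|Hp]]; simpl; try lra; apply Hb, in_or_app; auto.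
      * intros t.
        change (indicator ((s, w) :: A) t) with (chi s w t + indicator A t).
        destruct (chi_0_1 s w t) as [->|Ht]; [rewrite Rplus_0_l; apply H2|].
        rewrite Ht; apply chi_1 in Ht; split.
        -- destruct (Req_dec (indicator A t) 0) as [->|Hne]; [lra|].
           apply Hin in Hne; lra.
        -- intros _; apply Hc; unfold w in Ht; lra.
      * intros t Ht Pt; destruct (Rlt_le_dec t s).
        -- destruct (Hcov t) as (p & Hp & Hpt); auto; [lra|].
           exists p; split; auto; now right.
        -- exists (s, w); split; [now left|simpl; lra].
    + exists A, ((z, s) :: B); split; [|split; [exact H2|split; [|exact HB]]].
      * intros p Hp; apply in_app_or in Hp.
        destruct Hp as [Hp|[<-|Hp]]; simpl; try lra; apply Hb, in_or_app; auto.
      * intros t Ht Pt; destruct (Rlt_le_dec t s); [apply Hcov; auto; lra|].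
        exfalso; apply (Hc t); auto; unfold w in Ht; lra.
  - exists A, B; split; [|split; [auto|split]].
    + intros p Hp; specialize (H1 p Hp); lra.
    + intros t Ht; apply H3; lra.
    + nra.
Qed.

(** * The weighted sum of the two measures *)

Section Measure.
Variables (a b c : R) (n M : nat).
Hypotheses (Ha : 0 < a) (Hab : a < b) (Hn : (1 <= n)%nat).
Hypotheses (Hc0 : b - a < c - INR n * b) (Hc0' : c - INR n * b < a).
Hypothesis HM : INR n * b + 2 * a + 1 <= INR M * a.

Let S1 (t : R) : Prop := Sset a b c t /\ 0 <= t < c - INR n * b + a - b.
Let S2 (t : R) : Prop := Sset a b c t /\ c - INR n * b <= t < a.

(** From [t = r + m a + j b] with [t] in [-a, 0] follow [m <= 0] and [- m a <= n b + 2 a <= M a], so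
    [r] is one of the points at which [periodized] evaluates [g]. *)
Lemma tile_position (t r : R) (j m : Z) :
  - a <= t <= 0 -> tile a b c (Z.of_nat n) t j m r ->
  let i := Z.to_nat j in
  ((S1 r /\ In i (seq 0 (S n))) \/ (S2 r /\ In i (seq 0 n))) /\
  forall g, (forall s, 0 <= g s) -> 1 <= g r ->
    1 <= periodized a M g (t - INR i * b).
Proof.
  intros Ht (E & Hr & HS & Hj & Hc) i.
  rewrite <- INR_IZR_INZ in Hc.
  assert (Ei : INR i = IZR j) by (unfold i; rewrite INR_IZR_INZ, Z2Nat.id; auto).
  split.
  - destruct Hc as [[Hr' Hj']|[Hr' Hj']]; [left|right]; (split; [split; auto; lra|]);
      apply in_seq; unfold i; lia.
  - intros g Hg Hgr.
    assert (0 <= IZR j) by (apply IZR_le; auto).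
    assert (IZR j <= INR n) by (rewrite INR_IZR_INZ; apply IZR_le; destruct Hc; lia).
    assert (m <= 0)%Z.
    { apply Z.nlt_ge; intros Hm; apply Zlt_le_succ, IZR_le in Hm.
      rewrite succ_IZR in Hm; nra. }
    assert (Em : INR (Z.to_nat (- m)) = - IZR m)
      by (rewrite INR_IZR_INZ, Z2Nat.id, opp_IZR; auto; lia).
    replace r with (t - INR i * b + INR (Z.to_nat (- m)) * a) in Hgr
      by (rewrite Em, Ei; lra).
    eapply Rle_trans; [exact Hgr|apply periodized_ge_term; auto].
    apply INR_le; rewrite Em; nra.
Qed.

(** The measures are infima over independent coverings, so the bound for coverings passes first to
    [m1], with the covering of [S2] fixed, and then to [m2]. *)
Lemma measure_sum_ge (k : R) (m1 m2 : R) :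
  (forall t, - a <= t <= 0 -> exists A A',
     (forall p, In p A -> S1 p) /\ (forall p, In p A' -> S2 p) /\
     forall g h, (forall r, 0 <= g r) -> (forall r, 0 <= h r) ->
       (forall p, In p A -> 1 <= g p) -> (forall p, In p A' -> 1 <= h p) ->
       k <= tiling a b n M g h t) ->
  measure_is S1 m1 -> measure_is S2 m2 ->
  k * a <= (INR n + 1) * m1 + INR n * m2.
Proof.
  intros H [_ Hm1] [_ Hm2].
  assert (Hn' : 1 <= INR n) by (apply (le_INR 1); auto).
  assert (H1 : forall s', cover_sum S2 s' -> (k * a - INR n * s') / (INR n + 1) <= m1).
  { intros s' Hs'; apply Hm1; intros s Hs.
    apply Rmult_le_reg_r with (INR n + 1); [lra|].
    unfold Rdiv; rewrite Rmult_assoc, Rinv_l, Rmult_1_r by lra.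
    pose proof (cover_tiling_ge a b n M k s s' S1 S2 Ha Hs Hs' H); lra. }
  assert (H2 : (k * a - (INR n + 1) * m1) / INR n <= m2).
  { apply Hm2; intros s' Hs'; specialize (H1 s' Hs').
    apply Rmult_le_reg_r with (INR n); [lra|].
    unfold Rdiv; rewrite Rmult_assoc, Rinv_l, Rmult_1_r by lra.
    apply (Rmult_le_compat_r (INR n + 1)) in H1; [|lra].
    unfold Rdiv in H1; rewrite Rmult_assoc, Rinv_l, Rmult_1_r in H1; lra. }
  apply (Rmult_le_compat_r (INR n)) in H2; [|lra].
  unfold Rdiv in H2; rewrite Rmult_assoc, Rinv_l, Rmult_1_r in H2; lra.
Qed.

Lemma measure_sum_ge_one (m1 m2 : R) :
  (forall t, exists x, solution a b c 1 t x) ->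
  measure_is S1 m1 -> measure_is S2 m2 ->
  a <= (INR n + 1) * m1 + INR n * m2.
Proof.
  intros Hex Hm1 Hm2; rewrite <- (Rmult_1_l a); apply measure_sum_ge; auto.
  intros t Ht; destruct (Hex t) as [x Hx].
  destruct (solution_tile a b c (Z.of_nat n) Ha Hab) with (t := t) (x := x)
    as (j & m & r & _ & Htile); try rewrite <- INR_IZR_INZ; auto; try lia.
  destruct (tile_position t r j m Ht Htile) as [[[HS Hin]|[HS Hin]] Hp].
  - exists [r], []; split; [intros p [<-|[]]; auto|split; [easy|]].
    intros g h Hg Hh Hgr _; unfold tiling.
    eapply Rle_trans; [apply (Hp g); auto; apply Hgr; now left|].
    rewrite <- (Rplus_0_r (periodized _ _ _ _)); apply Rplus_le_compat.
    + apply (sumL_ge_term _ (fun j => periodized a M g (t - INR j * b))); auto.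
      intros; now apply periodized_nonneg.
    + apply sumL_nonneg; intros; now apply periodized_nonneg.
  - exists [], [r]; split; [easy|split; [intros p [<-|[]]; auto|]].
    intros g h Hg Hh _ Hhr; unfold tiling.
    eapply Rle_trans; [apply (Hp h); auto; apply Hhr; now left|].
    rewrite <- (Rplus_0_l (periodized _ _ _ _)); apply Rplus_le_compat.
    + apply sumL_nonneg; intros; now apply periodized_nonneg.
    + apply (sumL_ge_term _ (fun j => periodized a M h (t - INR j * b))); auto.
      intros; now apply periodized_nonneg.
Qed.

(** A 2-solution splits into two disjoint 1-solutions; their tiles have different [j], hence occupy
    different terms of the tiling sum. *)
Lemma measure_sum_ge_two (m1 m2 : R) :
  (forall t, exists x, solution a b c 2 t x) ->
  measure_is S1 m1 -> measure_is S2 m2 ->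
  2 * a <= (INR n + 1) * m1 + INR n * m2.
Proof.
  intros Hex Hm1 Hm2; apply measure_sum_ge; auto.
  intros t Ht; destruct (Hex t) as [x Hx].
  destruct (solution_split a b c Ha Hab t x Hx) as (y & z & Hy & Hz & Hyz).
  assert (Htile : forall w, solution a b c 1 t w ->
    exists j m r, w (- j)%Z = true /\ tile a b c (Z.of_nat n) t j m r).
  { intros w Hw; apply solution_tile; try rewrite <- INR_IZR_INZ; auto; lia. }
  destruct (Htile y Hy) as (j & m & r & Yj & Hj).
  destruct (Htile z Hz) as (j' & m' & r' & Zj & Hj').
  assert (Hne : Z.to_nat j <> Z.to_nat j').
  { assert (j <> j') by (intros <-; eauto).
    destruct Hj as (_ & _ & _ & Hj & _), Hj' as (_ & _ & _ & Hj' & _); lia. }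
  pose proof (tile_position t r j m Ht Hj) as [Hp Hg].
  pose proof (tile_position t r' j' m' Ht Hj') as [Hp' Hg'].
  clear Hj Hj' Yj Zj.
  set (i := Z.to_nat j) in *; set (i' := Z.to_nat j') in *; clearbody i i'.
  assert (H1 : forall K f i, (forall s, 0 <= f s) -> In i (seq 0 K) ->
    1 <= periodized a M f (t - INR i * b) ->
    1 <= sumL (seq 0 K) (fun j => periodized a M f (t - INR j * b))).
  { intros K f l Hf Hl Hl1; eapply Rle_trans; [exact Hl1|].
    apply (sumL_ge_term _ (fun j => periodized a M f (t - INR j * b))); auto.
    intros; now apply periodized_nonneg. }
  assert (H2 : forall K f, (forall s, 0 <= f s) -> In i (seq 0 K) -> In i' (seq 0 K) ->
    1 <= periodized a M f (t - INR i * b) -> 1 <= periodized a M f (t - INR i' * b) ->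
    2 <= sumL (seq 0 K) (fun j => periodized a M f (t - INR j * b))).
  { intros K f Hf Hi Hi' Hp1 Hp2.
    eapply Rle_trans; [|apply (sumL_ge_two_terms _
      (fun j => periodized a M f (t - INR j * b)) i i'); auto].
    - lra.
    - intros; now apply periodized_nonneg. }
  assert (H0 : forall K f, (forall s, 0 <= f s) ->
    0 <= sumL (seq 0 K) (fun j => periodized a M f (t - INR j * b))).
  { intros K f Hf; apply sumL_nonneg; intros; now apply periodized_nonneg. }
  destruct Hp as [[HS Hin]|[HS Hin]], Hp' as [[HS' Hin']|[HS' Hin']].
  - exists [r; r'], []; split; [intros p [<-|[<-|[]]]; auto|split; [easy|]].
    intros g h Pg Ph Hgr _; unfold tiling.
    specialize (H2 (S n) g Pg Hin Hin' (Hg g Pg (Hgr r ltac:(simpl; auto)))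
      (Hg' g Pg (Hgr r' ltac:(simpl; auto)))).
    specialize (H0 n h Ph); lra.
  - exists [r], [r']; split; [intros p [<-|[]]; auto|split; [intros p [<-|[]]; auto|]].
    intros g h Pg Ph Hgr Hhr; unfold tiling.
    pose proof (H1 (S n) g i Pg Hin (Hg g Pg (Hgr r ltac:(simpl; auto)))).
    pose proof (H1 n h i' Ph Hin' (Hg' h Ph (Hhr r' ltac:(simpl; auto)))); lra.
  - exists [r'], [r]; split; [intros p [<-|[]]; auto|split; [intros p [<-|[]]; auto|]].
    intros g h Pg Ph Hgr Hhr; unfold tiling.
    pose proof (H1 (S n) g i' Pg Hin' (Hg' g Pg (Hgr r' ltac:(simpl; auto)))).
    pose proof (H1 n h i Ph Hin (Hg h Ph (Hhr r ltac:(simpl; auto)))); lra.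
  - exists [], [r; r']; split; [easy|split; [intros p [<-|[<-|[]]]; auto|]].
    intros g h Pg Ph _ Hhr; unfold tiling.
    specialize (H2 n h Ph Hin Hin' (Hg h Ph (Hhr r ltac:(simpl; auto)))
      (Hg' h Ph (Hhr r' ltac:(simpl; auto)))).
    specialize (H0 (S n) g Pg); lra.
Qed.

(* A solution at [t] is unique, and right limits of solutions are solutions, so
   the entry at [0] cannot change immediately to the right of [t]. *)
Lemma Sset_right_constant :
  (forall t, ~ Dset a b c t) -> (forall t, exists x, solution a b c 1 t x) ->
  right_constant (Sset a b c).
Proof.
  intros HD Hex t.
  destruct (Hex t) as [x Hx].
  assert (Hloc : exists d, 0 < d /\ forall s y, t <= s < t + d ->
    solution a b c 1 s y -> y 0%Z = x 0%Z).
  { apply NNPP; intros Hno.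
    destruct (solution_right_limit a b c ltac:(lra) 1 t (fun v => v <> x 0%Z))
      as (y & Hy & Hne).
    - intros e He; apply NNPP; intros Hn'; apply Hno.
      exists e; split; auto; intros s y Hs Hy.
      apply NNPP; intros Hne; apply Hn'; eauto.
    - apply Hne; symmetry.
      apply (solution_unique a b c (Z.of_nat n)) with (t := t);
        try rewrite <- INR_IZR_INZ; auto; lia. }
  destruct Hloc as (d & Hd & Hloc); exists d; split; auto.
  destruct (x 0%Z) eqn:X0; [left|right]; intros s Hs.
  - destruct (Hex s) as [y Hy]; apply Sset_solution; exists y; split; eauto.
  - rewrite Sset_solution; intros (y & Y0 & Hy).
    rewrite (Hloc s y Hs Hy) in Y0; discriminate.
Qed.

(** Every nonzero term is a tile at [t] with coordinates [j] and [-m], and there is at most one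
    tile. So each of the two sums has at most one nonzero term, and they are not both nonzero
    because [S1] and [S2] are disjoint. *)
Lemma tiling_le_one (g h : R -> R) (t : R) :
  (forall s, ~ Dset a b c s) ->
  (forall s, 0 <= g s <= 1 /\ (g s <> 0 -> S1 s)) ->
  (forall s, 0 <= h s <= 1 /\ (h s <> 0 -> S2 s)) ->
  tiling a b n M g h t <= 1.
Proof.
  intros HD Hg Hh.
  assert (Htile : forall (j m : nat) r, r = t - INR j * b + INR m * a ->
    (S1 r /\ (j <= n)%nat) \/ (S2 r /\ (j < n)%nat) ->
    tile a b c (Z.of_nat n) t (Z.of_nat j) (- Z.of_nat m) r).
  { intros j m r E H; unfold tile; rewrite opp_IZR, <- !INR_IZR_INZ.
    destruct H as [[[HS Hr] Hj]|[[HS Hr] Hj]]; repeat split; auto; try lra; try lia.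
    - left; split; [lra|lia].
    - right; split; [lra|lia]. }
  assert (HU : forall (j m j' m' : nat) r r', r = t - INR j * b + INR m * a ->
    r' = t - INR j' * b + INR m' * a ->
    (S1 r /\ (j <= n)%nat) \/ (S2 r /\ (j < n)%nat) ->
    (S1 r' /\ (j' <= n)%nat) \/ (S2 r' /\ (j' < n)%nat) ->
    j = j' /\ m = m' /\ r = r').
  { intros j m j' m' r r' E E' H H'.
    destruct (tile_unique a b c (Z.of_nat n) Ha Hab) with (t := t) (r := r) (r' := r')
      (j := Z.of_nat j) (j' := Z.of_nat j') (m := (- Z.of_nat m)%Z)
      (m' := (- Z.of_nat m')%Z) as (Ej & Em & Er);
      try rewrite <- INR_IZR_INZ; auto; try lia.
    repeat split; auto; lia. }
  assert (Hnz : forall f K, sumL (seq 0 K) (fun j => periodized a M f (t - INR j * b)) <> 0 ->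
    exists j m, (j < K)%nat /\ f (t - INR j * b + INR m * a) <> 0).
  { intros f K H; apply sumL_nonzero in H; destruct H as (j & Hj & H).
    apply sumL_nonzero in H; destruct H as (m & _ & H).
    apply in_seq in Hj; exists j, m; split; auto; lia. }
  assert (Hle : forall f K (P : R -> Prop), (forall s, f s <= 1 /\ (f s <> 0 -> P s)) ->
    (forall (j m j' m' : nat) r r', r = t - INR j * b + INR m * a ->
      r' = t - INR j' * b + INR m' * a -> P r -> P r' -> (j < K)%nat -> (j' < K)%nat ->
      j = j' /\ m = m') ->
    sumL (seq 0 K) (fun j => periodized a M f (t - INR j * b)) <= 1).
  { intros f K P Hf HP; apply sumL_le_one; [apply seq_NoDup| |].
    - intros j Hj; apply in_seq in Hj.
      apply sumL_le_one; [apply seq_NoDup|intros; apply Hf|].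
      intros m m' _ _ Hm Hm'; apply Hf in Hm, Hm'.
      eapply (HP j m j m'); eauto; lia.
    - intros j j' Hj Hj' Nj Nj'; apply in_seq in Hj, Hj'.
      apply sumL_nonzero in Nj, Nj'.
      destruct Nj as (m & _ & Hm), Nj' as (m' & _ & Hm').
      apply Hf in Hm, Hm'; eapply (HP j m j' m'); eauto; lia. }
  assert (L1 : sumL (seq 0 (S n)) (fun j => periodized a M g (t - INR j * b)) <= 1).
  { apply (Hle g (S n) S1); [intros s; destruct (Hg s); split; auto; lra|].
    intros j m j' m' r r' E E' Hr Hr' Hj Hj'.
    destruct (HU j m j' m' r r') as (-> & -> & _); auto; left; split; auto; lia. }
  assert (L2 : sumL (seq 0 n) (fun j => periodized a M h (t - INR j * b)) <= 1).
  { apply (Hle h n S2); [intros s; destruct (Hh s); split; auto; lra|].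
    intros j m j' m' r r' E E' Hr Hr' Hj Hj'.
    destruct (HU j m j' m' r r') as (-> & -> & _); auto; right; split; auto; lia. }
  unfold tiling.
  destruct (Req_dec (sumL (seq 0 (S n)) (fun j => periodized a M g (t - INR j * b))) 0)
    as [->|N1]; [lra|].
  destruct (Req_dec (sumL (seq 0 n) (fun j => periodized a M h (t - INR j * b))) 0)
    as [->|N2]; [lra|].
  apply Hnz in N1, N2.
  destruct N1 as (j & m & Hj & Hm), N2 as (j' & m' & Hj' & Hm').
  apply Hg in Hm; apply Hh in Hm'.
  destruct (HU j m j' m' _ _ eq_refl eq_refl) as (_ & _ & E);
    [left; split; auto; lia|right; auto|].
  destruct Hm as [_ Hm], Hm' as [_ Hm']; lra.
Qed.

(** Each part of S is covered by disjoint intervals inside it and a remainder of length at most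
    [e (a + 1)]. The intervals inside satisfy the tiling bound, so integration bounds their weighted
    length by [a]. *)
Lemma measure_sum_le (m1 m2 : R) :
  (forall t, ~ Dset a b c t) -> (forall t, exists x, solution a b c 1 t x) ->
  measure_is S1 m1 -> measure_is S2 m2 ->
  (INR n + 1) * m1 + INR n * m2 <= a.
Proof.
  intros HD Hex [Hm1 _] [Hm2 _].
  pose proof (Sset_right_constant HD Hex) as HR.
  pose proof (pos_INR n).
  apply Rle_plus_epsilon; intros eps Heps.
  set (e := eps / ((2 * INR n + 1) * (a + 1))).
  assert (He : 0 < e) by (apply Rdiv_lt_0_compat; nra).
  assert (Ee : (2 * INR n + 1) * (e * (a + 1)) = eps) by (unfold e; field; lra).
  assert (Happ : forall l u m, 0 <= l -> u <= a ->
    (forall s, cover_sum (fun t => Sset a b c t /\ l <= t < u) s -> m <= s) ->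
    exists A, (forall p, In p A -> 0 <= fst p <= snd p /\ snd p <= a + 1) /\
      (forall t, indicator A t <= 1 /\ (indicator A t <> 0 -> Sset a b c t /\ l <= t < u)) /\
      m <= total_length A + e * (a + 1)).
  { intros l u m Hl Hu Hm.
    destruct (right_constant_approx (fun t => Sset a b c t /\ l <= t < u) 0 a e)
      as (A & B & H1 & H2 & H3 & H4); auto; [lra|apply right_constant_and; auto;
        apply right_constant_interval|].
    exists A; repeat split; try (apply H1, in_or_app; now left); try apply H2; auto.
    apply Rle_trans with (total_length (A ++ B)).
    - apply Hm, cover_sum_list; [intros p Hp; apply H1; auto|].
      intros t Ht; apply H3; auto; lra.
    - unfold total_length in *; rewrite sumL_app; lra. }
  destruct (Happ 0 (c - INR n * b + a - b) m1) as (A & HA & IA & LA); auto; try lra.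
  destruct (Happ (c - INR n * b) a m2) as (A' & HA' & IA' & LA'); auto; try lra.
  assert (HT : (INR n + 1) * total_length A + INR n * total_length A' <= a).
  { apply (tiling_le_length a b n M Ha (a + 1)); auto; try lra.
    intros t _; apply tiling_le_one; auto; intros s.
    - destruct (IA s) as [I1 I2].
      split; [split; [apply indicator_nonneg|exact I1]|exact I2].
    - destruct (IA' s) as [I1 I2].
      split; [split; [apply indicator_nonneg|exact I1]|exact I2]. }
  nra.
Qed.

End Measure.

Theorem theorem5p4 (a b c : R) :
  0 < a -> a < b -> b < c ->
  let N := rfloor (c / b) in
  let c0 := c - IZR N * b in
  let c1 := IZR N * b - IZR (rfloor (IZR N * b / a)) * a in
  b - a < c0 -> c0 < a ->
  0 < c1 -> c1 < 2 * a - b ->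
  (2 <= N)%Z ->
  (exists t, Sset a b c t) ->
  ((~ exists p q : Z, (q <> 0)%Z /\ a / b = IZR p / IZR q) \/
   (exists p q : Z, (0 < p)%Z /\ (0 < q)%Z /\ Z.gcd p q = 1%Z /\
      a / b = IZR p / IZR q /\ exists k : Z, c / b = IZR k / IZR q)) ->
  forall m1 m2 : R,
    measure_is (fun t => Sset a b c t /\ 0 <= t < c0 + a - b) m1 ->
    measure_is (fun t => Sset a b c t /\ c0 <= t < a) m2 ->
    ((forall t, ~ Dset a b c t) <->
     (IZR N + 1) * m1 + IZR N * m2 = a).
Proof.
  intros Ha Hab Hbc N c0 c1 Hc0 Hc0' _ _ HN [t0 HS] Hrat m1 m2 Hm1 Hm2.
  unfold c0 in *; clear c0 c1; clearbody N.
  assert (EN : IZR N = INR (Z.to_nat N)) by (rewrite INR_IZR_INZ, Z2Nat.id; auto; lia).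
  rewrite EN in *.
  assert (Hn : (1 <= Z.to_nat N)%nat) by lia.
  set (n := Z.to_nat N) in *; clearbody n; clear N HN EN.
  (* The terms [n b + 2 a] cover the shifts met by tiles at [t] in [-a, 0], and [n b + a + 1] is
     what integrating intervals within [0, a + 1] requires. *)
  assert (exists M : nat, INR n * b + 2 * a + 1 <= INR M * a) as [M HM].
  { destruct (INR_unbounded ((INR n * b + 2 * a + 1) / a)) as [M HM].
    exists M; apply (Rmult_lt_compat_r a) in HM; auto.
    unfold Rdiv in HM; rewrite Rmult_assoc, Rinv_l, Rmult_1_r in HM; lra. }
  assert (Hex : forall t, exists x, solution a b c 1 t x).
  { apply solution_exists_everywhere; auto; [lra|].
    apply Sset_solution in HS; destruct HS as (x & _ & Hx); eauto. }
  split.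
  - intros HD; apply Rle_antisym.
    + now apply (measure_sum_le a b c n M).
    + now apply (measure_sum_ge_one a b c n M).
  - intros E t HDt.
    assert (Hex2 : forall t, exists x, solution a b c 2 t x).
    { apply solution_exists_everywhere; auto; [lra|].
      apply Dset_solution in HDt; destruct HDt as (x & _ & Hx); eauto. }
    assert (2 * a <= (INR n + 1) * m1 + INR n * m2)
      by now apply (measure_sum_ge_two a b c n M).
    lra.
Qed.
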